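(* Let $l,N\ge 1$, let $\mu=(\mu_1,\dots,\mu_l)$ and $\lambda=(\lambda_1,\dots,\lambda_{l+N})$ be generalized partitions, and let $x^{\pm}=(x_1,x_1^{-1},\dots,x_N,x_N^{-1})$. Then the skew odd orthogonal character $so_{\lambda/\mu}(x^{\pm})=\langle\mu^{so}|\Gamma_+(x^{\pm})|\lambda^{so}\rangle$ satisfies $$\langle\mu^{so}|\Gamma_+(x^{\pm})|\lambda^{so}\rangle=so_{\lambda/\mu}(x^{\pm})=\det(a_{ij})_{1\le i,j\le l+N},$$ where $$a_{ij}=\begin{cases} h_{\lambda_i-\mu_j-i+j}(x^{\pm}), & 1\le j\le l,\\ h_{\lambda_i-i+j}(x^{\pm})+h_{\lambda_i-i-j+2l+1}(x^{\pm}), & l+1\le j\le l+N.\end{cases}$$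
   Context: A generalized partition is a weakly decreasing finite sequence of nonnegative integers (zeros allowed; the number of entries is recorded). Heisenberg algebra: generators $a_n$ ($n\in\mathbb Z\setminus\{0\}$) with $[a_m,a_n]=m\delta_{m,-n}$. The Fock space $\mathcal M$ is generated by the vacuum $|0\rangle$ with $a_n|0\rangle=0$ for $n>0$ (so $\mathcal M\cong\mathbb C[a_{-1},a_{-2},\dots]$), and $\langle 0|$ is the dual vacuum, a linear functional on $\mathcal M$ with $\langle 0|a_{-n}=0$ for $n>0$ and $\langle 0|1|0\rangle=1$. Vertex operators: $$U(z)=(1+z)\exp\Big(\sum_{n\ge1}\tfrac{a_{-n}}{n}z^n\Big)\exp\Big(-\sum_{n\ge1}\tfrac{a_n}{n}(z^n+z^{-n})\Big)=\sum_{n\in\mathbb Z}U_nz^{-n},$$ $$U^*(z)=(1-z)\exp\Big(-\sum_{n\ge1}\tfrac{a_{-n}}{n}z^n\Big)\exp\Big(\sum_{n\ge1}\tfrac{a_n}{n}(z^n+z^{-n})\Big)=\sum_{n\in\mathbb Z}U^*_nz^{n}.$$ The coefficients $U_n,U_n^*$ are operators on $\mathcal M$. For a generalized partition $\lambda=(\lambda_1,\dots,\lambda_k)$, $$|\lambda^{so}\rangle=U_{-\lambda_1}\cdots U_{-\lambda_k}|0\rangle,\qquad \langle\lambda^{so}|=\langle0|U^*_{-\lambda_k}\cdots U^*_{-\lambda_1}$$ (the latter is a linear functional on $\mathcal M$ and depends on the number $k$ of entries). Half vertex operators: $\Gamma_+(z)=\exp\big(\sum_{n\ge1}\frac{a_n}{n}z^n\big)$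 and $\Gamma_+(x^{\pm})=\prod_{i=1}^N\Gamma_+(x_i)\Gamma_+(x_i^{-1})$. The functions $h_n(x^{\pm})$ are defined by $\prod_{i=1}^N\frac{1}{(1-x_iz)(1-x_i^{-1}z)}=\sum_{n\in\mathbb Z}h_n(x^{\pm})z^n$, with $h_n(x^\pm)=0$ for $n<0$. *)

(* Defs.v *)
From HB Require Import structures.
From mathcomp Require Import all_boot all_order all_algebra.
From mathcomp Require Import boolp classical_sets functions cardinality fsbigop.
From mathcomp Require finmap monalg.

Set Implicit Arguments.
Unset Strict Implicit.
Unset Printing Implicit Defensive.

Import Order.TTheory GRing.Theory Num.Theory.

Local Open Scope classical_set_scope.
Local Open Scope ring_scope.

(* [heis n] is the action of a_n; [heis 0] is unconstrained and never used.
   [fock_ind] says that the module is generated by the vacuum.  In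
   characteristic 0 these axioms determine the module up to isomorphism: it is
   K[a_{-1}, a_{-2}, ...] with a_{-n} acting by multiplication and a_n by
   n d/da_{-n}; see [PolynomialFock.polynomial_fock] below. *)
Record fockSpace (K : fieldType) := FockSpace {
  fock_sort :> lmodType K;
  heis : int -> {linear fock_sort -> fock_sort};
  vac : fock_sort;
  dvac : {scalar fock_sort};
  heis_comm : forall (m n : int) (v : fock_sort), m != 0 -> n != 0 ->
    heis m (heis n v) - heis n (heis m v) =
      (if m == - n then m%:~R else 0) *: v;
  heis_vac : forall n : int, 0 < n -> heis n vac = 0;
  fock_ind : forall P : fock_sort -> Prop,
    P vac ->
    (forall (c : K) u v, P u -> P v -> P (c *: u + v)) ->
    (forall (n : int) v, n != 0 -> P v -> P (heis n v)) ->
    forall v, P v;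
  dvac_heis : forall (n : int) v, 0 < n -> dvac (heis (- n) v) = 0;
  dvac_vac : dvac vac = 1 }.

Module PolynomialFock.
Import finmap monalg.

Section Model.
Variable K : fieldType.
Local Notation V := {malg K[{cmonom nat}]}.
Implicit Types (m : {cmonom nat}) (k : nat).

(* Linear extension of a map defined on monomials. *)
Definition lin_ext (f : {cmonom nat} -> V) (g : V) : V :=
  \sum_(m <- msupp g) g@_m *: f m.

Lemma lin_extEw f (d : {fset {cmonom nat}}) (g : V) : (msupp g `<=` d)%fset ->
  lin_ext f g = \sum_(m <- d) g@_m *: f m.
Proof.
move=> le; rewrite /lin_ext (big_fset_incl _ le) //= => m _ /mcoeff_outdom ->.
by rewrite scale0r.
Qed.

Lemma lin_ext_is_linear f : linear (lin_ext f).
Proof.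
move=> c u v; pose d := (msupp (c *: u + v) `|` (msupp u `|` msupp v))%fset.
rewrite !(@lin_extEw f d) ?fsubsetUl //.
- rewrite scaler_sumr -big_split /=; apply: eq_bigr => m _.
  by rewrite mcoeffD mcoeffZ scalerDl scalerA.
- by rewrite (fsubset_trans (fsubsetUr _ _) (fsubsetUr _ _)).
- by rewrite (fsubset_trans (fsubsetUl _ _) (fsubsetUr _ _)).
Qed.

HB.instance Definition _ f :=
  GRing.isLinear.Build K V V *:%R (lin_ext f) (lin_ext_is_linear f).

Definition const_coef (g : V) : K := g@_mone.
Lemma const_coef_is_scalar : scalar const_coef.
Proof. by move=> c u v; rewrite /const_coef mcoeffD mcoeffZ. Qed.
HB.instance Definition _ :=
  GRing.isLinear.Build K V K *%R const_coef const_coef_is_scalar.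

(* The module is sealed because failed conversion checks between its concrete
   elements diverge. *)
Record basis := Basis {
  bmod : lmodType K;
  bmon : {cmonom nat} -> bmod;
  bmon_ind : forall P : bmod -> Prop,
    (forall (c : K) u v, P u -> P v -> P (c *: u + v)) ->
    (forall m, P (bmon m)) -> forall v, P v;
  bext : ({cmonom nat} -> bmod) -> {linear bmod -> bmod};
  extE : forall f m, bext f (bmon m) = f m;
  const : {scalar bmod};
  constE : forall m, const (bmon m) = (m == mone)%:R }.

Lemma basis_witness : basis.
Proof.
pose mon m : V := @mkmalgU {cmonom nat} K m 1.
have mon_ind (P : V -> Prop) :
    (forall (c : K) u v, P u -> P v -> P (c *: u + v)) ->
    (forall m, P (mon m)) -> forall v, P v.
  move=> PD PU v.
  have P0 : P 0.
    have -> : 0 = -1 *: mon mone + mon mone by rewrite scaleN1r addNr.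
    exact: PD.
  rewrite [v]monalgE; elim/big_rec: _ => // m u _ Pu.
  have -> : << v@_m *g m >> = v@_m *: mon m.
    apply: (iffLR (malgP _ _)) => m'.
    rewrite mcoeffZ; transitivity (v@_m *+ (m == m')).
      exact: mcoeffU.
    have -> : (mon m)@_m' = 1 *+ (m == m') by exact: mcoeffU.
    by rewrite mulrnAr mulr1.
  exact: PD.
apply: (@Basis V mon mon_ind (fun f => lin_ext f) _ const_coef).
  by move=> f m; rewrite /= (lin_extEw f msuppU_le) big_seq_fset1 mcoeffUU scale1r.
by move=> m; exact: mcoeffU.
Qed.

Let B := basis_witness.
Local Notation W := (bmod B).
Local Notation mon := (@bmon B).
Local Notation ext := (@bext B).
Let extU f m : ext f (mon m) = f m. Proof. exact: extE. Qed.
Let extZU f (c : K) m : ext f (c *: mon m) = c *: f m.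
Proof. by rewrite linearZ /= extE. Qed.

Lemma cm_eq (m1 m2 : {cmonom nat}) : (forall i, m1 i = m2 i) -> m1 = m2.
Proof. by move=> h; apply/eqP/cmP. Qed.

Lemma down_sig k m : {m' : {cmonom nat} | forall i, m' i = (m i - (k == i))%N}.
Proof. by exists (divcm m (ucm k)) => i; rewrite divcmE ucmE. Qed.
Lemma up_sig k m : {m' : {cmonom nat} | forall i, m' i = (m i + (k == i))%N}.
Proof. by exists (mulcm m (ucm k)) => i; rewrite mulcmE ucmE. Qed.

(* The variable of index k is a_{-(k+1)}; [down] and [up] divide and multiply
   a monomial by it. *)
Definition down k m := sval (down_sig k m).
Definition up k m := sval (up_sig k m).
Let downE k m i : down k m i = (m i - (k == i))%N.
Proof. exact: (svalP (down_sig k m)). Qed.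
Let upE k m i : up k m i = (m i + (k == i))%N.
Proof. exact: (svalP (up_sig k m)). Qed.

Definition lower k m : W := (k.+1 * m k)%:R *: mon (down k m).
Definition raise k m : W := mon (up k m).

Definition op (n : int) : {linear W -> W} :=
  match n with
  | Posz 0 => ext (fun=> 0)
  | Posz k.+1 => ext (lower k)
  | Negz k => ext (raise k)
  end.

Lemma lower_lower k k' m :
  ext (lower k) (lower k' m) = ext (lower k') (lower k m).
Proof.
have [->//|nkk'] := eqVneq k k'.
rewrite [lower k' m]/lower [lower k m]/lower !extZU /lower !downE.
rewrite [k' == k]eq_sym (negbTE nkk') !subn0 !scalerA mulrC.
congr (_ *: mon _); apply: cm_eq => a.
by rewrite !downE -!subnDA addnC.
Qed.

Lemma raise_raise k k' m :
  ext (raise k) (raise k' m) = ext (raise k') (raise k m).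
Proof.
rewrite [raise k' m]/raise [raise k m]/raise !extU /raise.
congr mon; apply: cm_eq => a.
by rewrite !upE -!addnA [X in (_ + X)%N]addnC.
Qed.

Lemma lower_raise k k' m :
  ext (lower k) (raise k' m) - ext (raise k') (lower k m) =
    (if k == k' then k.+1%:R else 0) *: mon m.
Proof.
rewrite [raise k' m]/raise [lower k m]/lower extU extZU /lower /raise.
rewrite upE [k' == k]eq_sym.
have [->|nkk'] := eqVneq k k'.
  have -> : down k' (up k' m) = m.
    by apply: cm_eq => a; rewrite downE upE addnK.
  have [mk0|mk0] := eqVneq (m k') 0%N.
    by rewrite mk0 muln0 scale0r subr0 muln1.
  have -> : up k' (down k' m) = m.
    apply: cm_eq => a; rewrite upE downE subnK //.
    by have [<-|//] := eqVneq k' a; rewrite lt0n.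
  by rewrite -scalerBl -natrB ?leq_mul2l ?leq_addr // -mulnBr addKn muln1.
rewrite addn0 scale0r; apply/eqP; rewrite subr_eq0; apply/eqP.
congr (_ *: mon _); apply: cm_eq => a.
rewrite !(downE, upE).
have [<-|_] := eqVneq k a; last by rewrite !subn0.
by rewrite [k' == k]eq_sym (negbTE nkk') !addn0.
Qed.

Lemma op_comm (i j : int) (v : W) : i != 0 -> j != 0 ->
  op i (op j v) - op j (op i v) = (if i == - j then i%:~R else 0) *: v.
Proof.
move=> i0 j0; move: v; apply: (@bmon_ind B) => [c u v Hu Hv|m].
  rewrite !linearP /= -Hu -Hv scalerBr.
  by rewrite -scalerN addrACA.
case: i i0 => [[//|k]|k] _; case: j j0 => [[//|k']|k'] _; rewrite /op 2!(extU _ m).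
- by rewrite lower_lower subrr scale0r.
- by rewrite lower_raise NegzE opprK eqz_nat eqSS.
- rewrite -opprB lower_raise -scaleNr; congr (_ *: _).
  rewrite NegzE eqr_opp eqz_nat eqSS [k == k']eq_sym.
  by case: eqP => [->|_]; rewrite ?oppr0 // mulrNz.
- by rewrite raise_raise subrr scale0r.
Qed.

Lemma op_vac (n : int) : 0 < n -> op n (mon mone) = 0.
Proof.
by case: n => [[|k]|k] // _; rewrite /op extU /lower cm1 muln0 scale0r.
Qed.

Lemma op_ind (P : W -> Prop) :
  P (mon mone) ->
  (forall (c : K) u v, P u -> P v -> P (c *: u + v)) ->
  (forall (n : int) v, n != 0 -> P v -> P (op n v)) ->
  forall v, P v.
Proof.
move=> P1 PD Pop; apply: (@bmon_ind B) => // m.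
have [n] := ubnP (mdeg m); elim: n m => // n IHn m; rewrite ltnS => mn.
have [m0|/fset0Pn[k]] := eqVneq (finsupp m) fset0.
  have -> // : m = mone.
  by apply: mdeg_eq0I; rewrite mdegE m0 big_seq_fset0.
rewrite -cmE_neq0 -lt0n => mk.
have mE : m = up k (down k m).
  apply: cm_eq => a; rewrite upE downE subnK //.
  by have [<-|//] := eqVneq k a.
have -> : mon m = op (Negz k) (mon (down k m)) by rewrite /op extU /raise -mE.
apply: Pop => //; apply: IHn; apply: leq_trans mn.
have -> : m = mulcm (down k m) (ucm k).
  by apply: cm_eq => a; rewrite mulcmE ucmE [in LHS]mE upE.
have -> : down k (mulcm (down k m) (ucm k)) = down k m.
  by apply: cm_eq => a; rewrite !downE mulcmE ucmE downE addnK.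
by rewrite mdegM mdegU addn1.
Qed.

Lemma const_op (n : int) v : 0 < n -> @const B (op (- n) v) = 0.
Proof.
case: n => [[|k]|k] // _; rewrite -NegzE; move: v.
apply: (@bmon_ind B) => [c u v Hu Hv|m].
  by rewrite !linearP /= Hu Hv mulr0 addr0.
rewrite /op extU /raise constE.
case: eqP => // /(congr1 (fun m' : {cmonom nat} => m' k)).
by rewrite upE eqxx addn1 cm1.
Qed.

Lemma const_vac : @const B (mon mone) = 1.
Proof. by rewrite constE eqxx. Qed.

Definition polynomial_fock : fockSpace K :=
  @FockSpace K W op (mon mone) (@const B) op_comm op_vac op_ind const_op
    const_vac.

End Model.
End PolynomialFock.

Section FormalDistributions.
Context {K : fieldType} {V : lmodType K}.

(* A formal distribution sum_{n in Z} A_n z^n with operator coefficients is the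
   function A.  The sums over [set: _] below are finite-support sums (they are 0
   when the support is infinite); for all the distributions considered here,
   only finitely many terms are nonzero on any given vector. *)
Definition distr := int -> V -> V.

Definition distr_one : distr := fun n v => if n == 0 then v else 0.
Definition distr_opp (A : distr) : distr := fun n v => - A n v.
Definition distr_mul (A B : distr) : distr := fun n v =>
  \sum_(i \in [set: int]) A i (B (n - i) v).
Definition distr_exp (A : distr) : distr := fun n v =>
  \sum_(m \in [set: nat]) (m`!%:R : K)^-1 *: iter m (distr_mul A) distr_one n v.
(* (1 + c z) A(z) *)
Definition distr_mul_lin (c : K) (A : distr) : distr := fun n v =>
  A n v + c *: A (n - 1) v.
Definition distr_eval (A : distr) (z : K) : V -> V := fun v =>
  \sum_(n \in [set: int]) z ^ n *: A n v.

End FormalDistributions.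
Arguments distr {K} V.

Section VertexOperators.
Context {K : fieldType} (M : fockSpace K).

(* sum_{n >= 1} (a_{-n} / n) z^n *)
Definition creation : distr M := fun n v =>
  if 0 < n then (n%:~R : K)^-1 *: heis M (- n) v else 0.

(* sum_{n >= 1} (a_n / n) z^n *)
Definition annihilation : distr M := fun n v =>
  if 0 < n then (n%:~R : K)^-1 *: heis M n v else 0.

(* sum_{n >= 1} (a_n / n) (z^n + z^{-n}) *)
Definition annihilation2 : distr M := fun n v =>
  annihilation n v + annihilation (- n) v.

Definition U_distr : distr M :=
  distr_mul_lin 1
    (distr_mul (distr_exp creation) (distr_exp (distr_opp annihilation2))).
Definition Ustar_distr : distr M :=
  distr_mul_lin (-1)
    (distr_mul (distr_exp (distr_opp creation)) (distr_exp annihilation2)).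

(* U_n is the coefficient of z^{-n} in U(z), U^*_n that of z^n in U^*(z). *)
Definition U (n : int) : M -> M := U_distr (- n).
Definition Ustar (n : int) : M -> M := Ustar_distr n.

Definition so_ket (lam : seq nat) : M :=
  foldr (fun (p : nat) v => U (- p%:Z) v) (vac M) lam.
(* U^*_{- lam_1} acts first. *)
Definition so_bra (lam : seq nat) (v : M) : K :=
  dvac M (foldl (fun w (p : nat) => Ustar (- p%:Z) w) v lam).

Definition Gamma_plus (z : K) : M -> M := distr_eval (distr_exp annihilation) z.
Definition Gamma_plus_pm (N : nat) (x : 'I_N -> K) : M -> M :=
  \big[comp/id]_(i < N) (Gamma_plus (x i) \o Gamma_plus (x i)^-1).

Definition skew_so (N : nat) (lam mu : seq nat) (x : 'I_N -> K) : K :=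
  so_bra mu (Gamma_plus_pm x (so_ket lam)).

End VertexOperators.

Definition gpartition (s : seq nat) : bool := sorted geq s.

Section CompleteSymmetric.
Context {K : fieldType}.

(* Coefficient of z^n in the power series 1 / P = sum_m (1 - P)^m, for
   P(0) = 1. *)
Definition inv_coef (P : {poly K}) (n : nat) : K :=
  (\sum_(m < n.+1) (1 - P) ^+ m)`_n.

Lemma inv_coefP (P : {poly K}) (n : nat) : P`_0 = 1 ->
  \sum_(i < n.+1) P`_i * inv_coef P (n - i) = (n == 0%N)%:R.
Proof.
move=> P0; pose Q := 1 - P.
have low k j : (j < k)%N -> (Q ^+ k)`_j = 0.
  move=> jk; have [q ->] : exists q, Q = q * 'X.
    have : root Q 0 by rewrite /root horner_coef0 coefB coef1 P0 subrr.
    by case/factor_theorem => q; rewrite subr0 => ->; exists q.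
  by rewrite exprMn coefMXn jk.
have wid j k : (j <= k)%N -> inv_coef P j = (\sum_(m < k.+1) Q ^+ m)`_j.
  move=> jk; rewrite /inv_coef !coef_sum.
  rewrite [RHS](big_ord_widen_cond _ xpredT (fun m => (Q ^+ m)`_j) (leqnn _)).
  rewrite (big_ord_widen k.+1 (fun m => (Q ^+ m)`_j)) //.
  rewrite [RHS](bigID (fun m : 'I_k.+1 => (m < j.+1)%N)) /=.
  rewrite [X in _ + X]big1 ?addr0; last first.
    by move=> m /andP[_]; rewrite -leqNgt; exact: low.
  by apply: eq_bigl => m; rewrite ltn_ord.
have -> : \sum_(i < n.+1) P`_i * inv_coef P (n - i) =
          (P * \sum_(m < n.+1) Q ^+ m)`_n.
  by rewrite coefM; apply: eq_bigr => i _; rewrite (@wid _ n) ?leq_subr.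
have -> : P * \sum_(m < n.+1) Q ^+ m = 1 - Q ^+ n.+1.
  by rewrite -opprB subrX1 -mulNr /Q opprB opprB addrCA subrr addr0.
by rewrite coefB low // subr0 coef1.
Qed.

Definition h_pm (N : nat) (x : 'I_N -> K) (n : int) : K :=
  if n is Posz k then
    inv_coef (\prod_(i < N) ((1 - x i *: 'X) * (1 - (x i)^-1 *: 'X))) k
  else 0.

End CompleteSymmetric.

(* Main.v *)
(* The modes of U and U^* are fermions: writing u_m = U_{-m} and
   u*_p = U^*_{-p}, one has u*_p u_m + u_{m+1} u*_{p+1} = delta_{p,m}; as both
   sides have the same commutators with all the a_{-k}, this needs to be checked
   on the vacuum only.  Moreover u*_p |0> = delta_{p,0} |0> for p >= 0 and
   <0| u*_p = - <0| u*_{-p-1}.  Conjugation by Gamma_+(x^{\pm}) turns u_m into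
   sum_k h_k u_{m-k}, which replaces delta_{p,m} by h_{m-p}.  Moving the
   u*_{mu_j} one after the other to the right through the product of these
   conjugates gives the Laplace expansions along the first l columns.  For the
   remaining columns, move both u*_{-n} and u*_{n-1} through a product of n
   factors: their contributions cancel under <0|, u*_{-n} becomes u*_0 on the
   right while u*_{n-1} kills the vacuum, and what is left is the Laplace
   expansion along the last column, whose entries are therefore sums of two
   h's. *)
Require Import Defs.
From mathcomp Require Import all_boot all_order all_algebra.
From mathcomp Require Import boolp classical_sets fsbigop.
From mathcomp Require Import zify ring.

Set Implicit Arguments.
Unset Strict Implicit.
Unset Printing Implicit Defensive.

Import Order.TTheory GRing.Theory Num.Theory.
Local Open Scope ring_scope.

(** * Identities in additive groups *)

(** The two orders of the product of U(z) and U^*(w) are expanded in opposite regions, so the factor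
    that their exchange produces cannot simply be cancelled. On the vacuum this leaves a relation
    multiplied by 1 - z w, with a formal delta function supported at w = z on the other side. The
    prefactors 1 + z and 1 - w are what turns it into the anticommutation relation, because their
    product is 1 - z w at w = z. The exponentials are never rearranged as series of words: an
    annihilating one is handled through its commutators with the a_{-k} and its value on the vacuum,
    a creating one through Newton's identity, a recursion in the degree with unique solutions in
    characteristic 0. The exchange of U with Gamma_+ is first obtained with a polynomial factor; the
    series of the h_n enters as the inverse of that polynomial. *)

Inductive zmod_expr :=
  ZAtom of nat | ZZero | ZAdd of zmod_expr & zmod_expr | ZOpp of zmod_expr.

Fixpoint zmod_eval (V : zmodType) (env : seq V) (e : zmod_expr) : V :=
  match e with
  | ZAtom i => nth 0 env i
  | ZZero => 0
  | ZAdd e1 e2 => zmod_eval env e1 + zmod_eval env e2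
  | ZOpp e1 => - zmod_eval env e1
  end.

Fixpoint zmod_coef (e : zmod_expr) (i : nat) : int :=
  match e with
  | ZAtom j => (i == j)%:Z
  | ZZero => 0
  | ZAdd e1 e2 => zmod_coef e1 i + zmod_coef e2 i
  | ZOpp e1 => - zmod_coef e1 i
  end.

Lemma zmod_eval_coef (V : zmodType) (env : seq V) (e : zmod_expr) :
  zmod_eval env e = \sum_(i < size env) nth 0 env i *~ zmod_coef e i.
Proof.
elim: e => [j||e1 IH1 e2 IH2|e IH] /=; rewrite ?IH1 ?IH2 ?IH.
- have [jn|jn] := ltnP j (size env); last first.
    rewrite nth_default // big1 // => i _.
    by rewrite ltn_eqF ?mulr0z //; apply: leq_trans jn.
  rewrite (bigD1 (Ordinal jn)) //= eqxx big1 ?addr0 // => i.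
  by rewrite -val_eqE => /negbTE /= ->; rewrite mulr0z.
- by rewrite big1.
- by rewrite -big_split; apply: eq_bigr => i _; rewrite mulrzDr.
- by rewrite -sumrN; apply: eq_bigr => i _; rewrite mulrNz.
Qed.

(** Reflection behind [zmod]: the goals live in modules, where [ring] does not apply, and comparing
    integer coefficients atom by atom is a computation. *)
Lemma zmod_eval_eq (V : zmodType) (env : seq V) (e1 e2 : zmod_expr) :
  all (fun i => zmod_coef e1 i == zmod_coef e2 i) (iota 0 (size env)) ->
  zmod_eval env e1 = zmod_eval env e2.
Proof.
move=> /allP eq12; rewrite !zmod_eval_coef; apply: eq_bigr => i _.
by rewrite (eqP (eq12 i _)) // mem_iota ltn_ord.
Qed.

(* [scalerN] may change the structure path in a scaling, hence the second
   case. *)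
Ltac zmod_index x env :=
  match env with
  | x :: _ => constr:(0%N)
  | @GRing.scale _ _ ?c ?y :: _ =>
    lazymatch x with @GRing.scale _ _ c y => constr:(0%N) end
  | _ :: ?env' => let i := zmod_index x env' in constr:(i.+1)
  end.

Ltac zmod_atoms t env :=
  lazymatch t with
  | ?a + ?b => let env' := zmod_atoms a env in zmod_atoms b env'
  | - ?a => zmod_atoms a env
  | 0 => env
  | ?x => match env with
          | _ => let i := zmod_index x env in env
          | _ => constr:(x :: env)
          end
  end.

Ltac zmod_quote t env :=
  lazymatch t with
  | ?a + ?b => let ea := zmod_quote a env in
               let eb := zmod_quote b env in constr:(ZAdd ea eb)
  | - ?a => let ea := zmod_quote a env in constr:(ZOpp ea)
  | 0 => constr:(ZZero)
  | ?x => let i := zmod_index x env in constr:(ZAtom i)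
  end.

(* Decides identities between integer combinations in an additive abelian
   group. *)
Ltac zmod :=
  lazymatch goal with
  | |- @eq ?V ?a ?b =>
    let env0 := zmod_atoms a (@nil V) in
    let env := zmod_atoms b env0 in
    let ea := zmod_quote a env in
    let eb := zmod_quote b env in
    apply: (@zmod_eval_eq _ env ea eb); vm_compute; reflexivity
  end.

(** * Finitely supported sums over the integers *)

Section LinearMaps.
Context {K : fieldType} {V W : lmodType K} {f : V -> W} (flin : linear f).

Lemma lin_0 : f 0 = 0.
Proof. by have := flin (-1) 0 0; rewrite scaler0 addr0 scaleN1r addNr. Qed.

Lemma lin_D : {morph f : u v / u + v}.
Proof. by move=> u v; have := flin 1 u v; rewrite !scale1r. Qed.

Lemma lin_Z (c : K) u : f (c *: u) = c *: f u.
Proof. by have := flin c u 0; rewrite lin_0 !addr0. Qed.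

Lemma lin_N : {morph f : u / - u}.
Proof. by move=> u; rewrite -!scaleN1r lin_Z. Qed.

End LinearMaps.

Section IntegerSums.

(** Such a sum is 0 by convention when the support is infinite, which is why the additivity laws
    below carry [finsupp_int] hypotheses. *)
Definition zsum (V : zmodType) (f : int -> V) : V :=
  (\sum_(i \in [set: int]%classic) f i)%R.

Definition finsupp_int (V : zmodType) (f : int -> V) : Prop :=
  exists B : nat, forall i : int, (B < `|i|)%N -> f i = 0.

Lemma zsum_ord (V : zmodType) (f : int -> V) (B : nat) :
  (forall i : int, (B < `|i|)%N -> f i = 0) ->
  zsum f = \sum_(k < B.*2.+1) f (k%:Z - B%:Z).
Proof.
move=> fB; rewrite /zsum.
rewrite (@fsbigE _ _ _ _ _ [seq k%:Z - B%:Z | k <- iota 0 B.*2.+1]) //.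
- rewrite -(big_mkord xpredT (fun k : nat => f (k%:Z - B%:Z))) /index_iota subn0.
  by rewrite big_map; apply: eq_bigl => i; rewrite in_setT.
- by rewrite map_inj_uniq ?iota_uniq // => i j; lia.
- move=> i _ iB; apply: fB; rewrite ltnNge; apply: contra iB => iB.
  by apply/mapP; exists (absz ((i : int) + B%:Z)); rewrite ?mem_iota; lia.
Qed.

Lemma eq_zsum (V : zmodType) (f g : int -> V) : f =1 g -> zsum f = zsum g.
Proof. by move=> /funext ->. Qed.

Lemma zsum_ind (V : zmodType) (P : V -> Prop) (f : int -> V) :
  P 0 -> (forall u v, P u -> P v -> P (u + v)) -> (forall i, P (f i)) ->
  P (zsum f).
Proof. by move=> P0 PD Pf; apply: big_ind. Qed.

Lemma zsum1 (V : zmodType) (f : int -> V) (k : int) :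
  (forall i, i != k -> f i = 0) -> zsum f = f k.
Proof.
move=> fk; rewrite (@zsum_ord _ _ `|k|); last first.
  by move=> i ki; apply: fk; apply: contraTneq ki => ->; rewrite ltnn.
have kB : (`|(k + `|k|%:Z)%R| < `|k|.*2.+1)%N by lia.
rewrite (bigD1 (Ordinal kB)) //= big1 ?addr0; first by congr f; lia.
move=> [j jB] /= /eqP njk; apply: fk; apply/eqP => jk; apply: njk.
by apply: val_inj => /=; lia.
Qed.

Lemma zsum0 (V : zmodType) (f : int -> V) : (forall i, f i = 0) -> zsum f = 0.
Proof. by move=> f0; rewrite (@zsum1 _ _ 0). Qed.

Lemma zsum_shift (V : zmodType) (f : int -> V) (k : int) :
  zsum (fun i => f (i - k)) = zsum f.
Proof.
rewrite [RHS]/zsum (@reindex_fsbigT _ _ _ _ _ (fun i => i - k)) //.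
by exists (fun i => i + k) => i; rewrite ?addrK ?subrK.
Qed.

Lemma finsupp_intD (V : zmodType) (f g : int -> V) :
  finsupp_int f -> finsupp_int g -> finsupp_int (fun i => f i + g i).
Proof.
move=> [B fB] [C gC]; exists (B + C)%N => i iBC.
by rewrite fB ?gC ?addr0 //; lia.
Qed.

Lemma finsupp_int_sub (V W : zmodType) (f : int -> V) (g : int -> W) :
  (forall i, f i = 0 -> g i = 0) -> finsupp_int f -> finsupp_int g.
Proof. by move=> fg [B fB]; exists B => i /fB /fg. Qed.

Lemma finsupp_int_shift (V : zmodType) (f : int -> V) (k : int) :
  finsupp_int f -> finsupp_int (fun i => f (i - k)).
Proof. by move=> [B fB]; exists (B + `|k|)%N => i iB; apply: fB; lia. Qed.

Lemma finsupp_int_between (V : zmodType) (f : int -> V) (a b : int) :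
  (forall i, i < a -> f i = 0) -> (forall i, b < i -> f i = 0) -> finsupp_int f.
Proof.
move=> fa fb; exists (`|a| + `|b|)%N => i iab.
by case: (ltP i a) => [/fa //|ai]; apply: fb; lia.
Qed.

Lemma zsumD (V : zmodType) (f g : int -> V) :
  finsupp_int f -> finsupp_int g ->
  zsum (fun i => f i + g i) = zsum f + zsum g.
Proof.
move=> [B fB] [C gC].
rewrite !(@zsum_ord _ _ (B + C)) ?big_split //= => i iBC.
- by rewrite gC //; lia.
- by rewrite fB //; lia.
- by rewrite fB ?gC ?addr0 //; lia.
Qed.

(** Finiteness is asked of [f] itself: [g] could kill all but finitely many terms of an infinite
    family, whose sum is 0 by convention. *)
Lemma zsum_morph (V W : zmodType) (g : V -> W) (f : int -> V) :
  g 0 = 0 -> {morph g : u v / u + v} -> finsupp_int f ->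
  g (zsum f) = zsum (fun i => g (f i)).
Proof.
move=> g0 gD [B fB]; rewrite !(@zsum_ord _ _ B) //; last by move=> i /fB ->.
exact: (big_morph g gD g0).
Qed.

(** The four terms are those of a product with (1 - z w) (1 - z / w), the factor that recurs in all
    exchange relations. *)
Lemma zsum_combine4 (V : zmodType) (f1 f2 f3 f4 : int -> V) :
  finsupp_int f1 -> finsupp_int f2 -> finsupp_int f3 -> finsupp_int f4 ->
  zsum f1 - zsum f2 - zsum f3 + zsum f4 =
  zsum (fun i => f1 i - f2 i - f3 i + f4 i).
Proof.
move=> [B1 fin1] [B2 fin2] [B3 fin3] [B4 fin4].
rewrite !(@zsum_ord _ _ (B1 + B2 + B3 + B4)) ?big_split /= ?sumrN // => i iB.
- by rewrite fin1 ?fin2 ?fin3 ?fin4 ?subr0 ?addr0 //; lia.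
- by rewrite fin4 //; lia.
- by rewrite fin3 //; lia.
- by rewrite fin2 //; lia.
- by rewrite fin1 //; lia.
Qed.

Lemma zsum_telescope (V : zmodType) (D : int -> V) (b : int) :
  (forall i, b < i -> D i = 0) ->
  zsum (fun i => if 0 < i then D i - D (i + 1) else 0) = D 1.
Proof.
(* Only an upper bound on the support of [D] is given, so [D] is cut to positive indices; the
   differences of [f] sum to 0, and index 0 accounts for [D 1]. *)
move=> Db; pose f i : V := if 0 < i then D i else 0.
have ffin : finsupp_int f.
  apply: (@finsupp_int_between _ _ 0 b) => i ib; first by rewrite /f ifN //; lia.
  by rewrite /f Db ?if_same.
transitivity (zsum (fun i => f i - f (i + 1) + (if i == 0 then D 1 else 0))).
  apply: eq_zsum => i; rewrite /f; have [->|i0] := eqVneq i 0.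
    by rewrite ltxx add0r ltr01 add0r addNr.
  rewrite addr0; case: ifP => i1; first by rewrite ifT //; lia.
  by rewrite ifN ?subr0 //; lia.
have fS : finsupp_int (fun i => f (i + 1)).
  by have := finsupp_int_shift (- 1) ffin; under eq_fun do rewrite opprK.
have fSN : finsupp_int (fun i => - f (i + 1)).
  by apply: finsupp_int_sub fS => i ->; rewrite oppr0.
have -> : zsum (fun i => f i - f (i + 1) + (if i == 0 then D 1 else 0)) =
    zsum f - zsum (fun i => f (i + 1)) +
    zsum (fun i => if i == 0 then D 1 else 0).
  rewrite zsumD; first 1 last.
  - exact: finsupp_intD.
  - by exists 0%N => i i0; rewrite ifN //; lia.
  congr (_ + _); rewrite zsumD // (@zsum_morph _ _ -%R) ?oppr0 //.
  exact: opprD.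
have -> : zsum (fun i => f (i + 1)) = zsum f.
  by rewrite -(zsum_shift f (- 1)); apply: eq_zsum => i; rewrite opprK.
by rewrite subrr add0r (@zsum1 _ _ 0) // => i /negbTE ->.
Qed.

Lemma exchange_zsum (V : zmodType) (f : int -> int -> V) (B : nat) :
  (forall i j, (B < `|i|)%N || (B < `|j|)%N -> f i j = 0) ->
  zsum (fun i => zsum (f i)) = zsum (fun j => zsum (f^~ j)).
Proof.
move=> fB; rewrite (@zsum_ord _ _ B); last first.
  by move=> i iB; apply: zsum0 => j; rewrite fB ?iB.
rewrite [RHS](@zsum_ord _ _ B); last first.
  by move=> j jB; apply: zsum0 => i; rewrite fB ?jB ?orbT.
transitivity (\sum_(k < B.*2.+1) \sum_(k' < B.*2.+1)
    f (k%:Z - B%:Z) (k'%:Z - B%:Z)).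
  by apply: eq_bigr => k _; apply: zsum_ord => j jB; rewrite fB ?jB ?orbT.
rewrite exchange_big; apply: eq_bigr => k _; apply/esym/zsum_ord => i iB.
by rewrite fB ?iB.
Qed.

End IntegerSums.

(** * Exponentials of creation and annihilation operators *)

Section FockSpace.
Context {K : fieldType} (M : fockSpace K).
Implicit Types (u v w : M) (k d m : nat) (n i j p q : int).

Lemma heisZ n (c : K) v : heis M n (c *: v) = c *: heis M n v.
Proof. exact: linearZ. Qed.

Lemma heisD n u v : heis M n (u + v) = heis M n u + heis M n v.
Proof. exact: linearD. Qed.

Lemma heisB n u v : heis M n (u - v) = heis M n u - heis M n v.
Proof. exact: linearB. Qed.

(** The span of the creation monomials is stable under every a_k with k > 0, because commuting a_k
    to the right ends at the vacuum. Operator identities thus reduce to the vacuum and to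
    commutators with the a_{-k}. *)
Lemma creation_ind (P : M -> Prop) :
  P (vac M) ->
  (forall (c : K) u v, P u -> P v -> P (c *: u + v)) ->
  (forall k v, (0 < k)%N -> P v -> P (heis M (- k%:Z) v)) ->
  forall v, P v.
Proof.
move=> P1 PD Pc.
(* Impredicative form of the smallest subspace that contains the vacuum and is stable under the
   creation operators. *)
pose S v := forall Q : M -> Prop, Q (vac M) ->
  (forall (c : K) u v, Q u -> Q v -> Q (c *: u + v)) ->
  (forall k v, (0 < k)%N -> Q v -> Q (heis M (- k%:Z) v)) -> Q v.
suff HS : forall v, S v by move=> v; exact: HS.
have S1 : S (vac M) by [].
have SD (c : K) u w : S u -> S w -> S (c *: u + w).
  by move=> Su Sw Q Q1 QD Qc; apply: (QD); [apply: Su | apply: Sw].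
have Sc k w : (0 < k)%N -> S w -> S (heis M (- k%:Z) w).
  by move=> k0 Sw Q Q1 QD Qc; apply: (Qc) => //; apply: Sw.
have S0 : S 0.
  have -> : 0 = -1 *: vac M + vac M by rewrite scaleN1r addNr.
  exact: SD.
suff Sa k w : (0 < k)%N -> S w -> S (heis M k%:Z w).
  apply: fock_ind => // n v n0 Sv.
  case: n n0 => [k|k] n0; first by apply: Sa => //; lia.
  by rewrite NegzE; apply: Sc.
(* Membership of [w] is carried along because the commutator of a_k with a creation operator returns
   a multiple of [w]. *)
move=> k0 Sw; suff [] : S w /\ S (heis M k%:Z w) by [].
apply: (Sw (fun w => S w /\ S (heis M k%:Z w))).
- by rewrite heis_vac ?ltz_nat.
- move=> c u v [Su Sau] [Sv Sav]; split; first exact: SD.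
  by rewrite linearP; apply: SD.
- move=> j v j0 [Sv Sav]; split; first exact: Sc.
  have := @heis_comm _ M k%:Z (- j%:Z) v.
  move=> /(_ _ _)/(canRL (subrK _)) -> //; [|by lia|by lia].
  by apply: SD => //; exact: Sc.
Qed.

(* With a_{-k} in degree k, [deg_lt d v] says that every component of [v] has
   degree less than [d]; in particular [deg_lt 0 v] means [v = 0]. *)
Definition deg_lt d v : Prop := forall ks : seq nat,
  all (ltn 0) ks -> (d <= sumn ks)%N ->
  foldl (fun w k => heis M k%:Z w) v ks = 0.

Lemma foldl_heisP (c : K) (ks : seq nat) u v :
  foldl (fun w k => heis M k%:Z w) (c *: u + v) ks =
  c *: foldl (fun w k => heis M k%:Z w) u ks +
  foldl (fun w k => heis M k%:Z w) v ks.
Proof. by elim: ks u v => //= k ks IH u v; rewrite linearP IH. Qed.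

Lemma deg_ltP d (c : K) u v : deg_lt d u -> deg_lt d v -> deg_lt d (c *: u + v).
Proof.
by move=> du dv ks ks0 dks; rewrite foldl_heisP du ?dv // scaler0 addr0.
Qed.

Lemma deg_lt_zero d : deg_lt d 0.
Proof. by move=> ks _ _; elim: ks => //= k ks; rewrite linear0. Qed.

Lemma deg_ltD d u v : deg_lt d u -> deg_lt d v -> deg_lt d (u + v).
Proof. by move=> du dv; rewrite -[u]scale1r; apply: deg_ltP. Qed.

Lemma deg_ltZ d (c : K) v : deg_lt d v -> deg_lt d (c *: v).
Proof. by move=> dv; rewrite -[_ *: _]addr0; apply/deg_ltP/deg_lt_zero. Qed.

Lemma deg_lt0 v : deg_lt 0 v -> v = 0.
Proof. by move/(_ [::]); apply. Qed.

Lemma deg_lt_le d d' v : (d <= d')%N -> deg_lt d v -> deg_lt d' v.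
Proof. by move=> dd' dv ks ks0 d'ks; apply: dv => //; apply: leq_trans d'ks. Qed.

Lemma deg_lt_heis d k v : (0 < k)%N -> deg_lt d v ->
  deg_lt (d - k) (heis M k%:Z v).
Proof.
move=> k0 dv ks ks0 dks; apply: (dv (k :: ks)) => /=; first by rewrite k0.
by rewrite -leq_subLR.
Qed.

Lemma deg_lt_vac : deg_lt 1 (vac M).
Proof.
move=> [|k ks] //= /andP[k0 _] _; rewrite heis_vac ?ltz_nat //.
by elim: ks => //= k' ks; rewrite linear0.
Qed.

Lemma deg_lt_create d k v : (0 < k)%N -> deg_lt d v ->
  deg_lt (d + k) (heis M (- k%:Z) v).
Proof.
move=> k0 dv ks; elim: ks d v dv => [|j ks IH] d v dv /=; first by lia.
move=> /andP[j0 ks0] dks.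
have := @heis_comm _ M j%:Z (- k%:Z) v.
move=> /(_ _ _)/(canRL (subrK _)) ->; [|by lia|by lia].
rewrite foldl_heisP opprK eqz_nat; have [jk|jk] := eqVneq j k; last first.
  (* For [j > d] the truncated [d - j] would make the degree count too weak, but then a_j already
     kills [v]. *)
  rewrite scale0r add0r; have [jd|jd] := leqP j d.
    by apply: (IH _ _ (deg_lt_heis j0 dv)) => //; lia.
  have -> : heis M j v = 0.
    by have := deg_lt_heis j0 dv; rewrite (eqP (ltnW jd)) => /deg_lt0.
  by rewrite linear0; apply: (@deg_lt_zero 0).
rewrite dv ?scaler0 ?add0r //; last by lia.
have [jd|jd] := leqP j d.
  by apply: (IH _ _ (deg_lt_heis j0 dv)) => //; lia.
have -> : heis M j v = 0.
  by have := deg_lt_heis j0 dv; rewrite (eqP (ltnW jd)) => /deg_lt0.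
by rewrite linear0; apply: (@deg_lt_zero 0).
Qed.

Lemma ex_deg_lt v : exists d, deg_lt d v.
Proof.
move: v; apply: creation_ind; first by exists 1%N; exact: deg_lt_vac.
  move=> c u v [d du] [d' dv]; exists (d + d')%N.
  by apply: deg_ltP; [apply: deg_lt_le du | apply: deg_lt_le dv]; lia.
by move=> k v k0 [d dv]; exists (d + k)%N; apply: deg_lt_create.
Qed.

Lemma deg_lt_zsum d (f : int -> M) : (forall i, deg_lt d (f i)) ->
  deg_lt d (zsum f).
Proof. by apply: zsum_ind; [exact: deg_lt_zero | exact: deg_ltD]. Qed.

(* The coefficients of [exp (sum_n (c_n / |n|) a_{|n|} z^n)]-like
   distributions; [g] records the commutators with the a_{-k}. *)
Record annihilating (T : distr M) (g : int -> K) : Prop := Annihilating {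
  ann_lin : forall n (c : K) u v, T n (c *: u + v) = c *: T n u + T n v;
  ann_comm : forall n k v, (0 < k)%N -> T n (heis M (- k%:Z) v) =
    heis M (- k%:Z) (T n v) +
    (g k%:Z *: T (n - k%:Z) v + g (- k%:Z) *: T (n + k%:Z) v);
  ann_vac : forall n, T n (vac M) = if n == 0 then vac M else 0;
  ann_fin : forall d v n, deg_lt d v -> (d <= `|n|)%N -> T n v = 0 }.

(** * Powers and exponentials of series of annihilation operators *)

Section AnnihilationExp.
Variable c : int -> K.
Hypothesis c0 : c 0 = 0.
(** Both signs of [n] give annihilation operators, so that one-sided and two-sided series are
    treated at once. *)
Let A : distr M := fun n v => c n *: heis M `|n|%N v.
Let P m : distr M := iter m (distr_mul A) distr_one.

Let PS m n v : P m.+1 n v = zsum (fun i => A i (P m (n - i) v)).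
Proof. by []. Qed.

Let Alin n (a : K) u v : A n (a *: u + v) = a *: A n u + A n v.
Proof. by rewrite /A linearP scalerDr !scalerA mulrC. Qed.

Let A0 n : A n 0 = 0.
Proof. by rewrite /A linear0 scaler0. Qed.

Let AD n : {morph A n : u v / u + v}.
Proof. by move=> u v; rewrite /A linearD scalerDr. Qed.

Let Adeg d n v : deg_lt d v -> deg_lt (d - maxn 1 `|n|) (A n v).
Proof.
move=> dv; rewrite /A; have [->|n0] := eqVneq n 0.
  by rewrite c0 scale0r; apply: deg_lt_zero.
rewrite (_ : maxn 1 `|n| = `|n|%N); last by lia.
by apply/deg_ltZ/deg_lt_heis => //; lia.
Qed.

(** Each of the [m] factors lowers the degree by the absolute value of its index, which is at least
    1, and the indices sum to [n]. The bound by [m] makes the exponential a finite sum on each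
    vector, the bound by the absolute value of [n] gives [ann_fin]. *)
Let Pdeg d m n v : deg_lt d v -> deg_lt (d - maxn m `|n|) (P m n v).
Proof.
move=> dv; elim: m n => [|m IH] n.
  rewrite /P /= /distr_one; case: eqP => [->|_]; last exact: deg_lt_zero.
  by rewrite maxn0 subn0.
rewrite PS; apply: deg_lt_zsum => i.
by apply: deg_lt_le (@Adeg _ i _ (IH (n - i))); lia.
Qed.

Let P0 d m n v : deg_lt d v -> (d <= maxn m `|n|)%N -> P m n v = 0.
Proof.
by move=> /(@Pdeg _ m n)/[swap] dm; rewrite (eqP dm) => /deg_lt0.
Qed.

Let Pfin m n v : finsupp_int (fun i => A i (P m (n - i) v)).
Proof.
have [d dv] := ex_deg_lt v; exists (d + `|n|)%N => i di.
by rewrite (P0 dv) ?A0 //; lia.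
Qed.

Let Plin m n (a : K) u v : P m n (a *: u + v) = a *: P m n u + P m n v.
Proof.
elim: m n => [|m IH] n.
  by rewrite /P /= /distr_one; case: ifP => _; rewrite ?scaler0 ?addr0.
rewrite !PS; under eq_zsum => i do rewrite IH Alin.
rewrite zsumD //; last first.
  by apply: finsupp_int_sub (Pfin m n u) => i ->; rewrite scaler0.
congr (_ + _); rewrite (@zsum_morph _ _ (fun v => a *: v)) ?scaler0 //.
exact: scalerDr.
Qed.

Let g i := c i * `|i|%N%:R.

Let Acomm n k v : (0 < k)%N -> A n (heis M (- k%:Z) v) =
  heis M (- k%:Z) (A n v) + (if `|n|%N == k then g n else 0) *: v.
Proof.
move=> k0; rewrite /A /g; have [->|n0] := eqVneq n 0.
  by rewrite c0 mul0r !scale0r linear0 if_same scale0r addr0.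
have := @heis_comm _ M `|n|%N%:Z (- k%:Z) v.
move=> /(_ _ _)/(canRL (subrK _)) ->; [|by lia|by lia].
rewrite scalerDr heisZ addrC opprK eqz_nat; congr (_ + _).
by case: ifP => _; rewrite ?scale0r ?scaler0 // scalerA.
Qed.

(** The commutator of the series [A] with a_{-k} is the scalar series g_k z^k + g_{-k} z^{-k}, so
    the Leibniz rule gives [m.+1] equal terms. *)
Let Pcomm m n k v : (0 < k)%N -> P m.+1 n (heis M (- k%:Z) v) =
  heis M (- k%:Z) (P m.+1 n v) +
  m.+1%:R *: (g k%:Z *: P m (n - k%:Z) v + g (- k%:Z) *: P m (n + k%:Z) v).
Proof.
move=> k0.
(* One application of the Leibniz rule: the first factor is commuted past a_{-k}, and [S] stands for
   the correction coming from the remaining factors. *)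
have step m' n' (S : int -> M) : finsupp_int (fun i => A i (S i)) ->
    (forall i, P m' (n' - i) (heis M (- k%:Z) v) =
      heis M (- k%:Z) (P m' (n' - i) v) + S i) ->
    P m'.+1 n' (heis M (- k%:Z) v) = heis M (- k%:Z) (P m'.+1 n' v) +
      ((g k%:Z *: P m' (n' - k%:Z) v + g (- k%:Z) *: P m' (n' + k%:Z) v) +
      zsum (fun i => A i (S i))).
  move=> Sfin PSi; rewrite !PS; under eq_zsum => i do rewrite PSi AD Acomm //.
  have fin1 : finsupp_int (fun i => heis M (- k%:Z) (A i (P m' (n' - i) v))).
    by apply: finsupp_int_sub (Pfin m' n' v) => i ->; rewrite linear0.
  have fin2 : finsupp_int (fun i =>
      (if `|i|%N == k then g i else 0) *: P m' (n' - i) v).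
    by exists k => i ik; rewrite ifN ?scale0r //; lia.
  rewrite zsumD //; last exact: finsupp_intD.
  rewrite zsumD // -addrA; congr (_ + (_ + _)).
    by rewrite (@zsum_morph _ _ (heis M (- k%:Z))) ?linear0 //; apply: linearD.
  have -> : zsum (fun i => (if `|i|%N == k then g i else 0) *: P m' (n' - i) v) =
      zsum (fun i => (if i == k%:Z then g i else 0) *: P m' (n' - i) v +
                     (if i == - k%:Z then g i else 0) *: P m' (n' - i) v).
    apply: eq_zsum => i; have [->|ik] := eqVneq i k%:Z.
      by rewrite eqxx ifN ?scale0r ?addr0 //; lia.
    rewrite scale0r add0r; have [->|ik'] := eqVneq i (- k%:Z).
      by rewrite ifT //; lia.
    by rewrite ifN //; lia.
  rewrite zsumD.
  - rewrite (@zsum1 _ _ k%:Z); last by move=> i /negbTE ->; rewrite scale0r.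
    rewrite eqxx (@zsum1 _ _ (- k%:Z)) ?eqxx ?opprK //.
    by move=> i /negbTE ->; rewrite scale0r.
  - by exists k => i ik; rewrite ifN ?scale0r //; lia.
  - by exists k => i ik; rewrite ifN ?scale0r //; lia.
elim: m n => [|m IH] n.
  rewrite (step _ _ (fun=> 0)).
  - by rewrite zsum0 ?addr0 ?scale1r.
  - by exists 0%N.
  - by move=> i; rewrite /P /= /distr_one; case: ifP => _; rewrite ?linear0 addr0.
have Sfin : finsupp_int (fun i => A i (m.+1%:R *:
    (g k%:Z *: P m (n - i - k%:Z) v + g (- k%:Z) *: P m (n - i + k%:Z) v))).
  have [d dv] := ex_deg_lt v; exists (d + `|n| + k)%N => i di.
  by rewrite !(P0 dv) ?scaler0 ?addr0 ?scaler0 ?A0 //; lia.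
rewrite (step _ _ (fun i => m.+1%:R *:
    (g k%:Z *: P m (n - i - k%:Z) v + g (- k%:Z) *: P m (n - i + k%:Z) v))) //.
congr (_ + _); rewrite [m.+2%:R]mulrS scalerDl scale1r; congr (_ + _).
transitivity (zsum (fun i =>
   m.+1%:R *: (g k%:Z *: A i (P m (n - k%:Z - i) v)) +
   m.+1%:R *: (g (- k%:Z) *: A i (P m (n + k%:Z - i) v)))).
  apply: eq_zsum => i; rewrite -scalerDr /A heisZ linearD !heisZ.
  rewrite (addrAC n) (addrAC n k%:Z) !scalerDr !scalerA.
  by congr (_ *: _ + _ *: _); ring.
have pull (a b : K) n' : zsum (fun i => a *: (b *: A i (P m (n' - i) v))) =
    a *: (b *: P m.+1 n' v).
  rewrite PS (@zsum_morph _ _ (fun w => a *: (b *: w))) ?scaler0 //.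
  by move=> x y; rewrite !scalerDr.
have fin (a b : K) n' :
    finsupp_int (fun i => a *: (b *: A i (P m (n' - i) v))).
  by apply: finsupp_int_sub (Pfin m n' v) => i ->; rewrite !scaler0.
by rewrite zsumD ?pull ?scalerDr.
Qed.

Let T := distr_exp A.

Let TE d n v : deg_lt d v -> forall D, (d <= D)%N ->
  T n v = \sum_(m < D) (m`!%:R : K)^-1 *: P m n v.
Proof.
move=> dv D dD; rewrite (fsbig_ord _ D (fun m => (m`!%:R : K)^-1 *: P m n v)).
apply/esym/fsbig_widen => //.
move=> m [_ /= /negP]; rewrite -leqNgt => Dm.
by rewrite -/(P m) (P0 dv) ?scaler0 //; lia.
Qed.

Hypothesis charK : [pchar K] =i pred0.

Lemma annihilation_exp : annihilating T g.
Proof.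
split.
- move=> n a u v; have [d du] := ex_deg_lt u; have [d' dv] := ex_deg_lt v.
  have {du}du : deg_lt (d + d') u by apply: deg_lt_le du; lia.
  have {dv}dv : deg_lt (d + d') v by apply: deg_lt_le dv; lia.
  rewrite !(TE _ _ (leqnn (d + d'))) //; last exact: deg_ltP.
  rewrite scaler_sumr -big_split; apply: eq_bigr => m _.
  by rewrite Plin scalerDr !scalerA mulrC.
- move=> n k v k0; have [d dv] := ex_deg_lt v.
  (* The commutator lowers the exponent by one, so the sums for T_n are cut one term later than
     those for T_{n-k} and T_{n+k}. *)
  rewrite (TE _ (deg_lt_create k0 dv) (leqnSn _)).
  rewrite [T n v](TE _ dv (leq_trans (leq_addr _ _) (leqnSn (d + k)))).
  rewrite !(TE _ dv (leq_addr k d)).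
  rewrite !big_ord_recl /= linearD linear_sum -addrA; congr (_ + _).
    rewrite heisZ; congr (_ *: _).
    by rewrite /P /= /distr_one; case: ifP => _; rewrite ?linear0.
  rewrite !scaler_sumr -!big_split; apply: eq_bigr => m _.
  rewrite /bump leq0n add1n /= -![distr_mul A _]/(P m.+1).
  rewrite Pcomm // scalerDr heisZ; congr (_ + _).
  rewrite scalerA mulrC.
  have -> : m.+1%:R / m.+1`!%:R = (m`!%:R)^-1 :> K.
    rewrite factS natrM invfM mulrA divff ?mul1r //.
    by rewrite (pcharf0P K).1.
  by rewrite scalerDr !scalerA ![_^-1 * _]mulrC.
- move=> n; rewrite (TE _ deg_lt_vac (leqnn _)) big_ord1 fact0 invr1 scale1r.
  by [].
- move=> d v n dv dn; rewrite (TE _ dv (leqnn _)) big1 // => m _.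
  by rewrite (P0 dv) ?scaler0 //; lia.
Qed.

End AnnihilationExp.

(* The last field is Newton's identity
   [z E'(z) = eps (sum_k a_{-k} z^k) E(z)]. *)
Record creating (E : distr M) (eps : K) : Prop := Creating {
  cre_lin : forall n (c : K) u v, E n (c *: u + v) = c *: E n u + E n v;
  cre_neg : forall n v, n < 0 -> E n v = 0;
  cre_0 : forall v, E 0 v = v;
  cre_comm : forall n k v, (0 < k)%N ->
    E n (heis M (- k%:Z) v) = heis M (- k%:Z) (E n v);
  cre_newton : forall n v, n%:~R *: E n v =
    eps *: zsum (fun i => if 0 < i then heis M (- i) (E (n - i) v) else 0) }.

(** * Powers and exponentials of series of creation operators *)

Section CreationExp.
Variable eps : K.
Hypothesis charK : [pchar K] =i pred0.
Let c i : K := if 0 < i then eps / i%:~R else 0.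
Let A : distr M := fun n v => c n *: heis M (- n) v.
Let P m : distr M := iter m (distr_mul A) distr_one.

Let PS m n v : P m.+1 n v = zsum (fun i => A i (P m (n - i) v)).
Proof. by []. Qed.

Let Alin n (a : K) u v : A n (a *: u + v) = a *: A n u + A n v.
Proof. by rewrite /A linearP scalerDr !scalerA mulrC. Qed.

Let A0 n : A n 0 = 0.
Proof. by rewrite /A linear0 scaler0. Qed.

Let AD n : {morph A n : u v / u + v}.
Proof. by move=> u v; rewrite /A linearD scalerDr. Qed.

Let AZ n (a : K) v : A n (a *: v) = a *: A n v.
Proof. by have := Alin n a v 0; rewrite A0 !addr0. Qed.

Let Aneg n v : n <= 0 -> A n v = 0.
Proof. by move=> n0; rewrite /A /c ltNge n0 scale0r. Qed.

Let Pneg m n v : n < m%:Z -> P m n v = 0.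
Proof.
elim: m n v => [|m IH] n v nm.
  by rewrite /P /= /distr_one ifN //; lia.
rewrite PS zsum0 // => i; case: (leP i 0) => [/Aneg //|i0].
by rewrite IH ?A0 //; lia.
Qed.

Let Pfin m n v : finsupp_int (fun i => A i (P m (n - i) v)).
Proof.
apply: (@finsupp_int_between _ _ 0 n) => i ni; first by apply: Aneg; lia.
by rewrite Pneg ?A0 //; lia.
Qed.

Let Plin m n (a : K) u v : P m n (a *: u + v) = a *: P m n u + P m n v.
Proof.
elim: m n => [|m IH] n.
  by rewrite /P /= /distr_one; case: ifP => _; rewrite ?scaler0 ?addr0.
rewrite !PS; under eq_zsum => i do rewrite IH Alin.
rewrite zsumD //; last first.
  by apply: finsupp_int_sub (Pfin m n u) => i ->; rewrite scaler0.
congr (_ + _); rewrite (@zsum_morph _ _ (fun v => a *: v)) ?scaler0 //.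
exact: scalerDr.
Qed.

Lemma heis_creation_comm i j v : 0 < i -> 0 < j ->
  heis M (- i) (heis M (- j) v) = heis M (- j) (heis M (- i) v).
Proof.
move=> i0 j0; have := @heis_comm _ M (- i) (- j) v.
move=> /(_ _ _)/(canRL (subrK _)) ->; [|by lia|by lia].
by rewrite ifN ?scale0r ?add0r //; lia.
Qed.

Let Acomm i j v : 0 < j -> A i (heis M (- j) v) = heis M (- j) (A i v).
Proof.
move=> j0; case: (leP i 0) => [i0|i0]; first by rewrite !Aneg ?linear0.
by rewrite /A heis_creation_comm // heisZ.
Qed.

Let Pcomm m n j v : 0 < j -> P m n (heis M (- j) v) = heis M (- j) (P m n v).
Proof.
move=> j0; elim: m n => [|m IH] n.
  by rewrite /P /= /distr_one; case: ifP => _; rewrite ?linear0.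
rewrite !PS; under eq_zsum => i do rewrite IH Acomm //.
by rewrite (@zsum_morph _ _ (heis M (- j))) ?linear0 //; apply: linearD.
Qed.

(** The derivation z d/dz applied to a power of A(z): creation operators commute, so the
    differentiated factor can always be moved to the front. *)
Let Pnewton m n v : n%:~R *: P m.+1 n v =
  m.+1%:R *: zsum (fun i => i%:~R *: A i (P m (n - i) v)).
Proof.
have scale_morph (a : K) : {morph (fun w : M => a *: w) : x y / x + y}.
  exact: scalerDr.
have fin1 m' n' : finsupp_int (fun i => i%:~R *: A i (P m' (n' - i) v)).
  by apply: finsupp_int_sub (Pfin m' n' v) => i ->; rewrite scaler0.
elim: m n => [|m IH] n.
  rewrite PS (zsum_morph (scaler0 _ _) (scale_morph _) (Pfin _ _ _)) scale1r.
  apply: eq_zsum => i; rewrite /P /= /distr_one; case: ifP; last first.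
    by rewrite A0 !scaler0.
  by rewrite subr_eq0 => /eqP ->.
rewrite PS (zsum_morph (scaler0 _ _) (scale_morph _) (Pfin _ _ _)).
(* The weight [n = i + (n - i)] is split between the first factor and the remaining power. *)
have -> : zsum (fun i => n%:~R *: A i (P m.+1 (n - i) v)) =
    zsum (fun i => i%:~R *: A i (P m.+1 (n - i) v)) +
    zsum (fun i => A i ((n - i)%:~R *: P m.+1 (n - i) v)).
  rewrite -zsumD //; last first.
    apply: (@finsupp_int_between _ _ 0 n) => i ni; first by apply: Aneg; lia.
    by rewrite Pneg ?scaler0 ?A0 //; lia.
  apply: eq_zsum => i; rewrite AZ -scalerDl -intrD; congr (_%:~R *: _).
  by rewrite addrCA subrr addr0.
rewrite [m.+2%:R]mulrS scalerDl scale1r; congr (_ + _).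
under eq_zsum => i do rewrite IH.
under eq_zsum => i do
  rewrite AZ (zsum_morph (A0 i) (AD i) (fin1 m (n - i))).
have vanish i j : (`|n| < `|i|)%N || (`|n| < `|j|)%N ->
    A i (j%:~R *: A j (P m (n - i - j) v)) = 0.
  move=> nij; case: (leP i 0) => [/Aneg //|i0].
  case: (leP j 0) => [/Aneg ->|j0]; first by rewrite scaler0 A0.
  by rewrite Pneg ?A0 ?scaler0 ?A0 //; lia.
rewrite -(@zsum_morph _ _ (fun w : M => m.+1%:R *: w)) ?scaler0 //; last first.
  by exists `|n|%N => i ni; apply: zsum0 => j; rewrite vanish ?ni.
congr (_ *: _); rewrite (@exchange_zsum _ _ `|n|) //.
apply: eq_zsum => j; rewrite PS.
rewrite [A j _](zsum_morph (A0 j) (AD j) (Pfin _ _ _)).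
rewrite (zsum_morph (scaler0 _ _) (scale_morph _)); last first.
  by apply: finsupp_int_sub (Pfin m (n - j) v) => i ->; rewrite A0.
apply: eq_zsum => i; rewrite AZ addrAC; congr (_ *: _).
case: (leP i 0) => [i0|i0]; first by rewrite ![A i _]Aneg // A0.
by rewrite [A i (P _ _ _)]/A AZ Acomm.
Qed.

Let E := distr_exp A.

Let EE n v D : n < D%:Z -> E n v = \sum_(m < D) (m`!%:R : K)^-1 *: P m n v.
Proof.
move=> nD; rewrite (fsbig_ord _ D (fun m => (m`!%:R : K)^-1 *: P m n v)).
apply/esym/fsbig_widen => // m [_ /= /negP]; rewrite -leqNgt => Dm.
by rewrite -/(P m) Pneg ?scaler0 //; lia.
Qed.

Let EB n v := @EE n v `|n|.+1.

Lemma creation_exp : creating E eps.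
Proof.
have nB n : n < `|n|.+1%:Z by lia.
split.
- move=> n a u v; rewrite !EB // scaler_sumr -big_split.
  by apply: eq_bigr => m _; rewrite Plin scalerDr !scalerA mulrC.
- by move=> n v n0; rewrite (@EE n v 0) ?big_ord0.
- by move=> v; rewrite (@EE 0 v 1) // big_ord1 fact0 invr1 scale1r.
- move=> n k v k0; rewrite !EB // linear_sum; apply: eq_bigr => m _.
  by rewrite Pcomm ?ltz_nat // heisZ.
- move=> n v; have scale_morph (a : K) :
      {morph (fun w : M => a *: w) : x y / x + y} by exact: scalerDr.
  have vanish m i : (`|n| < `|i|)%N -> i%:~R *: A i (P m (n - i) v) = 0.
    move=> ni; case: (leP i 0) => [/Aneg ->|i0]; first by rewrite scaler0.
    by rewrite Pneg ?A0 ?scaler0 //; lia.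
  have vanishE i : (`|n| < `|i|)%N ->
      (if 0 < i then heis M (- i) (E (n - i) v) else 0) = 0.
    move=> ni; case: ifP => // i0.
    by rewrite (@EE _ v 0) ?big_ord0 ?linear0 //; lia.
  rewrite (zsum_morph (scaler0 _ _) (scale_morph _)); last by exists `|n|%N.
  transitivity (zsum (fun i => i%:~R *: A i (E (n - i) v))); last first.
    apply: eq_zsum => i; rewrite /A /c scalerA; case: ifP => i0; last first.
      by rewrite mulr0 scale0r scaler0.
    rewrite mulrC divfK // -[i]gez0_abs; last by lia.
    by rewrite (pcharf0P K).1 //; lia.
  (* One term more than needed: the term of exponent 0 is concentrated in degree 0 and disappears
     under the weight [n]; the others are lowered by one through [Pnewton]. *)
  rewrite (@EE n v `|n|.+2); last by lia.
  rewrite big_ord_recl scalerDr scaler_sumr.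
  rewrite (_ : n%:~R *: _ = 0) ?add0r; last first.
    rewrite /P /= /distr_one; case: eqP => [->|_]; last by rewrite !scaler0.
    by rewrite scale0r.
  transitivity (\sum_(m < `|n|.+1)
      zsum (fun i => (m`!%:R : K)^-1 *: (i%:~R *: A i (P m (n - i) v)))).
    apply: eq_bigr => m _; rewrite lift0 scalerA mulrC -scalerA.
    rewrite Pnewton scalerA factS natrM invfM mulrAC mulVf ?mul1r; last first.
      by rewrite (pcharf0P K).1.
    rewrite (zsum_morph (scaler0 _ _) (scale_morph _)) //.
    by exists `|n|%N => i; exact: vanish.
  rewrite (eq_bigr (fun m : 'I_ `|n|.+1 => \sum_(k < `|n|.*2.+1)
     (m`!%:R : K)^-1 *: ((k%:Z - `|n|%N%:Z)%:~R *:
        A (k%:Z - `|n|%N%:Z) (P m (n - (k%:Z - `|n|%N%:Z)) v)))); last first.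
    by move=> m _; apply: zsum_ord => i ni; rewrite vanish ?scaler0.
  rewrite exchange_big (@zsum_ord _ _ `|n|) /=; last first.
    move=> i ni; case: (leP i 0) => [/Aneg ->|i0]; first by rewrite scaler0.
    by rewrite (@EE _ v 0) ?big_ord0 ?A0 ?scaler0 //; lia.
  apply: eq_bigr => k _; set i := k%:Z - _.
  case: (leP i 0) => i0.
    by rewrite big1 ?Aneg ?scaler0 // => m _; rewrite Aneg ?scaler0.
  rewrite (@EE _ v `|n|.+1); last by lia.
  rewrite (big_morph (A i) (AD i) (A0 i)) scaler_sumr; apply: eq_bigr => m _.
  by rewrite /A heisZ !scalerA; congr (_ *: _); ring.
Qed.

End CreationExp.

Lemma ann_add T g n : annihilating T g -> {morph T n : u v / u + v}.
Proof. by move=> HT; apply: (lin_D (ann_lin HT n)). Qed.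

Lemma cre_zero E eps n : creating E eps -> E n 0 = 0.
Proof. by move=> HE; apply: (lin_0 (cre_lin HE n)). Qed.

Lemma cre_add E eps n : creating E eps -> {morph E n : u v / u + v}.
Proof. by move=> HE; apply: (lin_D (cre_lin HE n)). Qed.

Lemma cre_scale E eps n (c : K) v : creating E eps -> E n (c *: v) = c *: E n v.
Proof. by move=> HE; apply: (lin_Z (cre_lin HE n)). Qed.

Lemma cre_opp E eps n v : creating E eps -> E n (- v) = - E n v.
Proof. by move=> HE; apply: (lin_N (cre_lin HE n)). Qed.

Definition newton_sum (X : int -> M) n : M :=
  zsum (fun i => if 0 < i then heis M (- i) (X (n - i)) else 0).

Lemma newton_sum_finsupp (X : int -> M) n : (forall j, j < 0 -> X j = 0) ->
  finsupp_int (fun i => if 0 < i then heis M (- i) (X (n - i)) else 0).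
Proof.
move=> X0; apply: (@finsupp_int_between _ _ 0 n) => i ni.
  by rewrite ifN //; lia.
by rewrite X0 ?linear0 ?if_same //; lia.
Qed.

(** * Consequences of Newton's recursion *)

Section CharacteristicZero.
Hypothesis charK : [pchar K] =i pred0.

Lemma intr_neq0 n : n != 0 -> n%:~R != 0 :> K.
Proof.
case: n => n n0; first by rewrite (pcharf0P K).1.
by rewrite NegzE mulrNz oppr_eq0 (pcharf0P K).1.
Qed.

(** For n > 0 the recursion expresses n X_n through the X_j with j < n, and n is invertible.
    Identities between exponentials are proved by checking this recursion. *)
Lemma cre_unique E eps (X : int -> M) : creating E eps ->
  (forall n, n < 0 -> X n = 0) ->
  (forall n, n%:~R *: X n = eps *: newton_sum X n) ->
  forall n, X n = E n (X 0).
Proof.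
move=> HE X0 XN n; case: (ltP n 0) => [n0|].
  by rewrite X0 // (cre_neg HE).
case: n => // n _; elim/ltn_ind: n => n IH.
have [->|n0] := eqVneq n 0%N; first by rewrite (cre_0 HE).
apply: (scalerI (@intr_neq0 n%:Z _)) => //=.
rewrite XN (cre_newton HE); congr (_ *: _); apply: eq_zsum => i.
case: ifP => // i0; congr (heis M _ _).
have [ni|ni] := ltP (n%:Z - i) 0; first by rewrite X0 // (cre_neg HE).
by have := IH (absz (n%:Z - i)); rewrite gez0_abs //; apply; lia.
Qed.

(** For fixed [i], the left side solves the recursion of [E2] in [j] with initial value [E1 i v]. *)
Lemma cre_commute E1 eps1 E2 eps2 i j v :
  creating E1 eps1 -> creating E2 eps2 -> E1 i (E2 j v) = E2 j (E1 i v).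
Proof.
move=> H1 H2; have := @cre_unique E2 eps2 (fun j => E1 i (E2 j v)) H2.
move=> -> => [|n n0|n]; first by rewrite (cre_0 H2).
  by rewrite (cre_neg H2) // (cre_zero _ H1).
rewrite -(cre_scale _ _ _ H1) (cre_newton H2) (cre_scale _ _ _ H1).
congr (_ *: _); rewrite (zsum_morph (cre_zero _ H1) (cre_add _ H1)).
  apply: eq_zsum => k; case: ifP => [k0|_]; last exact: cre_zero H1.
  by rewrite -[k]gez0_abs ?(cre_comm H1) //; lia.
by apply: (@newton_sum_finsupp (E2^~ v)) => k k0; rewrite (cre_neg H2).
Qed.

(** Under z d/dz the two factors contribute opposite multiples of the same series, so n times the
    n-th coefficient of the product is 0. *)
Lemma cre_inverse E E' (eps : K) n v : creating E eps -> creating E' (- eps) ->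
  zsum (fun i => E i (E' (n - i) v)) = if n == 0 then v else 0.
Proof.
move=> HE HE'; have [->|n0] := eqVneq n 0.
  rewrite (@zsum1 _ _ 0) ?subr0 ?(cre_0 HE) ?(cre_0 HE') // => i i0.
  case: (ltP i 0) => [/(cre_neg HE) //|?].
  by rewrite (cre_neg HE') ?(cre_zero _ HE) //; lia.
apply: (scalerI (intr_neq0 n0)); rewrite scaler0.
have scale_morph (a : K) : {morph (fun w : M => a *: w) : x y / x + y}.
  exact: scalerDr.
have fin : finsupp_int (fun i => E i (E' (n - i) v)).
  apply: (@finsupp_int_between _ _ 0 n) => i ni; first by rewrite (cre_neg HE).
  by rewrite (cre_neg HE') ?(cre_zero _ HE) //; lia.
rewrite (zsum_morph (scaler0 _ _) (scale_morph _)) //.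
pose Y i (k : int) : M :=
  if 0 < k then heis M (- k) (E i (E' (n - i - k) v)) else 0.
pose X i (k : int) : M :=
  if 0 < k then heis M (- k) (E (i - k) (E' (n - i) v)) else 0.
have Y0 i (k : int) : (`|n| < `|i|)%N || (`|n| < `|k|)%N -> Y i k = 0.
  rewrite /Y; case: ifP => // k0 ik; case: (ltP i 0) => i0.
    by rewrite (cre_neg HE) ?linear0.
  by rewrite (cre_neg HE') ?(cre_zero _ HE) ?linear0 //; lia.
have X0 i (k : int) : (`|n| < `|i|)%N || (`|n| < `|k|)%N -> X i k = 0.
  rewrite /X; case: ifP => // k0 ik; case: (ltP (i - k) 0) => i0.
    by rewrite (cre_neg HE) ?linear0.
  by rewrite (cre_neg HE') ?(cre_zero _ HE) ?linear0 //; lia.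
transitivity (zsum (fun i => eps *: zsum (X i) + - eps *: zsum (Y i))).
  apply: eq_zsum => i; rewrite -[n in n%:~R](subrK i) intrD scalerDl addrC.
  congr (_ + _); first exact: (cre_newton HE).
  rewrite -(cre_scale _ _ _ HE) (cre_newton HE') (cre_scale _ _ _ HE).
  congr (_ *: _); rewrite (zsum_morph (cre_zero _ HE) (cre_add _ HE)).
    apply: eq_zsum => k; rewrite /Y; case: ifP => [k0|_]; last exact: cre_zero HE.
    by rewrite -[k]gez0_abs ?(cre_comm HE) //; lia.
  by apply: (@newton_sum_finsupp (E'^~ v)) => k k0; rewrite (cre_neg HE').
have scale_zsum (a : K) (Z : int -> int -> M) :
    (forall i (k : int), (`|n| < `|i|)%N || (`|n| < `|k|)%N -> Z i k = 0) ->
    finsupp_int (fun i => a *: zsum (Z i)).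
  move=> Z0; exists `|n|%N => i ni.
  by rewrite zsum0 ?scaler0 // => k; rewrite Z0 ?ni.
have finZ (Z : int -> int -> M) :
    (forall i (k : int), (`|n| < `|i|)%N || (`|n| < `|k|)%N -> Z i k = 0) ->
    finsupp_int (fun i => zsum (Z i)).
  by move=> Z0; exists `|n|%N => i ni; rewrite zsum0 // => k; rewrite Z0 ?ni.
rewrite zsumD; [|exact: scale_zsum|exact: scale_zsum].
rewrite -!(zsum_morph (scaler0 _ _) (scale_morph _)); [|exact: finZ|exact: finZ].
rewrite scaleNr; apply/eqP; rewrite subr_eq0; apply/eqP; congr (_ *: _).
rewrite (exchange_zsum X0) (exchange_zsum Y0); apply: eq_zsum => k.
rewrite -[RHS](zsum_shift _ k); apply: eq_zsum => i; rewrite /X /Y.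
by case: ifP => // _; congr (heis M _ (E _ (E' _ _))); lia.
Qed.

(* With [T(w) = sum_p T_p w^p], the conclusion reads
   [E(z) T(w) = (1 - z w) (1 - z / w) T(w) E(z)]; both sides solve Newton's
   recursion in the degree of z. *)
Lemma cre_ann_exchange E eps (T : int -> M -> M) (eta : K) :
  creating E eps -> eps * eta = 1 ->
  (forall p (c : K) u v, T p (c *: u + v) = c *: T p u + T p v) ->
  (forall p k v, (0 < k)%N -> T p (heis M (- k%:Z) v) =
     heis M (- k%:Z) (T p v) + eta *: (T (p - k%:Z) v + T (p + k%:Z) v)) ->
  forall n p v, E n (T p v) =
    T p (E n v) - T (p - 1) (E (n - 1) v) - T (p + 1) (E (n - 1) v) +
    T p (E (n - 2) v).
Proof.
move=> HE epseta Tlin Tcomm n p v.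
have T0 q : T q 0 = 0 := lin_0 (Tlin q).
have TD q : {morph T q : x y / x + y} := lin_D (Tlin q).
have TZ q (c : K) w : T q (c *: w) = c *: T q w := lin_Z (Tlin q) c w.
pose L j q := T q (E j v).
have Lneg j q : j < 0 -> L j q = 0 by move=> j0; rewrite /L (cre_neg HE).
pose S j q := zsum (fun i => if 0 < i then L (j - i) (q - i) + L (j - i) (q + i)
                             else 0).
have Sfin j q : finsupp_int (fun i =>
    if 0 < i then L (j - i) (q - i) + L (j - i) (q + i) else 0).
  apply: (@finsupp_int_between _ _ 0 j) => i ij; first by rewrite ifN //; lia.
  by rewrite !Lneg ?addr0 ?if_same //; lia.
(* Newton's identity for [E] seen through [T]: [S] collects the commutators of [T] with the a_{-i},
   whose coefficient is eps * eta = 1. *)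
have LN j q : j%:~R *: L j q = eps *: newton_sum (L^~ q) j + S j q.
  rewrite -TZ (cre_newton HE) TZ (zsum_morph (T0 _) (TD _)); last first.
    by apply: (@newton_sum_finsupp (E^~ v)) => k k0; rewrite (cre_neg HE).
  transitivity (eps *: zsum (fun i =>
     (if 0 < i then heis M (- i) (L (j - i) q) else 0) +
     eta *: (if 0 < i then L (j - i) (q - i) + L (j - i) (q + i) else 0))).
    congr (_ *: _); apply: eq_zsum => i; case: ifP => [i0|_].
      by rewrite -[i]gez0_abs ?Tcomm //; lia.
    by rewrite T0 scaler0 addr0.
  rewrite zsumD; first 1 last.
  - by apply: (@newton_sum_finsupp (L^~ q)) => k; apply: Lneg.
  - by apply: finsupp_int_sub (Sfin j q) => i ->; rewrite scaler0.
  rewrite -(@zsum_morph _ _ (fun w : M => eta *: w)) ?scaler0 //; last first.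
    exact: scalerDr.
  by rewrite scalerDr scalerA epseta scale1r.
pose W j := L j p - L (j - 1) (p - 1) - L (j - 1) (p + 1) + L (j - 2) p.
have Wneg j : j < 0 -> W j = 0.
  by move=> j0; rewrite /W !Lneg ?subr0 ?addr0 //; lia.
have WN j : j%:~R *: W j = eps *: newton_sum W j.
  (* Each shifted term receives the weight of its own degree in z; the excess subtracted last is
     minus z d/dz of (1 - z w) (1 - z / w), that is z w + z / w - 2 z^2. *)
  have -> : j%:~R *: W j =
      j%:~R *: L j p - (j - 1)%:~R *: L (j - 1) (p - 1)
      - (j - 1)%:~R *: L (j - 1) (p + 1) + (j - 2)%:~R *: L (j - 2) p
      - (L (j - 1) (p - 1) - L (j - 2) p + (L (j - 1) (p + 1) - L (j - 2) p)).
    rewrite /W !intrB !scalerBl !scalerDr !scalerN.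
    rewrite (_ : (2 : int)%:~R = 1 + 1 :> K) // scalerDl !scale1r; zmod.
  rewrite !LN.
  have -> : newton_sum W j = newton_sum (L^~ p) j
      - newton_sum (L^~ (p - 1)) (j - 1) - newton_sum (L^~ (p + 1)) (j - 1)
      + newton_sum (L^~ p) (j - 2).
    have fin (m : int) q : finsupp_int (fun i =>
        if 0 < i then heis M (- i) (L (m - i) q) else 0).
      by apply: (@newton_sum_finsupp (L^~ q)) => k; apply: Lneg.
    rewrite zsum_combine4 //.
    apply: eq_zsum => i; case: ifP => _; last by rewrite !subr0 addr0.
    rewrite /W linearD !linearB /= (addrAC j (- i)) (addrAC j (- i) (- 2)).
    by [].
  (* [S] is [L] multiplied by z w / (1 - z w) + (z / w) / (1 - z / w). Multiplying by (1 - z w) (1 -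
     z / w) leaves the same z w + z / w - 2 z^2; [D1] and [D2] are the two telescoping parts. *)
  have -> : L (j - 1) (p - 1) - L (j - 2) p + (L (j - 1) (p + 1) - L (j - 2) p) =
      S j p - S (j - 1) (p - 1) - S (j - 1) (p + 1) + S (j - 2) p.
    rewrite zsum_combine4 //.
    pose D1 i := L (j - i) (p - i) - L (j - i - 1) (p - i + 1).
    pose D2 i := L (j - i) (p + i) - L (j - i - 1) (p + i - 1).
    transitivity (D1 1 + D2 1).
      by congr (L _ _ - L _ _ + (L _ _ - L _ _)); lia.
    rewrite -(@zsum_telescope _ D1 j) => [|i ij]; last first.
      by rewrite /D1 !Lneg ?subr0 //; lia.
    rewrite -(@zsum_telescope _ D2 j) => [|i ij]; last first.
      by rewrite /D2 !Lneg ?subr0 //; lia.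
    rewrite -zsumD; first 1 last.
    - apply: (@finsupp_int_between _ _ 0 j) => i ij; first by rewrite ifN //; lia.
      by rewrite /D1 !Lneg ?subr0 ?if_same //; lia.
    - apply: (@finsupp_int_between _ _ 0 j) => i ij; first by rewrite ifN //; lia.
      by rewrite /D2 !Lneg ?subr0 ?if_same //; lia.
    apply: eq_zsum => i; case: ifP => _; last by rewrite !subr0 !addr0.
    rewrite /D1 /D2.
    rewrite (_ : j - 1 - i = j - i - 1); last by ring.
    rewrite (_ : j - 2 - i = j - i - 2); last by ring.
    rewrite (_ : j - (i + 1) = j - i - 1); last by ring.
    rewrite (_ : j - i - 1 - 1 = j - i - 2); last by ring.
    rewrite (_ : p - 1 - i = p - i - 1); last by ring.
    rewrite (_ : p + 1 - i = p - i + 1); last by ring.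
    rewrite (_ : p - 1 + i = p + i - 1); last by ring.
    rewrite (_ : p + 1 + i = p + i + 1); last by ring.
    rewrite (_ : p - (i + 1) = p - i - 1); last by ring.
    rewrite (_ : p + (i + 1) = p + i + 1); last by ring.
    rewrite (_ : p - i - 1 + 1 = p - i); last by ring.
    rewrite (_ : p + i + 1 - 1 = p + i); last by ring.
    zmod.
  rewrite !scalerDr !scalerN; zmod.
rewrite -/(W n) (cre_unique HE Wneg WN) /W !(@Lneg (0 - _)) //.
by rewrite !subr0 addr0 /L (cre_0 HE).
Qed.
End CharacteristicZero.

End FockSpace.

(** * Vertex operators *)

Section VertexOperators.
Context {K : fieldType} (charK : [pchar K] =i pred0) (M : fockSpace K).
Implicit Types (u v w : M) (k d m : nat) (n i j p q : int).

(* The commutators of [exp (eta * sum_n (a_n / n) (z^n + z^{-n}))]. *)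
Definition two_sided (eta : K) (i : int) : K := if i == 0 then 0 else eta.

Lemma two_sided_comm (T : distr M) (eta : K) n k v :
  annihilating T (two_sided eta) -> (0 < k)%N ->
  T n (heis M (- k%:Z) v) =
  heis M (- k%:Z) (T n v) + eta *: (T (n - k%:Z) v + T (n + k%:Z) v).
Proof.
move=> HT k0; rewrite (ann_comm HT) // scalerDr /two_sided.
by rewrite !ifN //; lia.
Qed.

Lemma two_sided_exp (A : distr M) (eta : K) :
  (forall n v, A n v =
    (if n == 0 then 0 else eta / `|n|%N%:R) *: heis M `|n|%N v) ->
  annihilating (distr_exp A) (two_sided eta).
Proof.
move=> AE; pose c n : K := if n == 0 then 0 else eta / `|n|%N%:R.
have -> : A = (fun n v => c n *: heis M `|n|%N v).
  by apply/funext => n; apply/funext => v; rewrite AE.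
have -> : two_sided eta = (fun i => c i * `|i|%N%:R).
  apply/funext => i; rewrite /two_sided /c; case: eqP => [_|i0].
    by rewrite mul0r.
  by rewrite divfK // (pcharf0P K).1 //; lia.
by apply: annihilation_exp => //; rewrite /c eqxx.
Qed.

Lemma annihilation2E n v : @annihilation2 K M n v =
  (if n == 0 then 0 else 1 / `|n|%N%:R) *: heis M `|n|%N v.
Proof.
rewrite /annihilation2 /annihilation mul1r; case: n => [[|m]|m] /=.
- by rewrite scale0r addr0.
- by rewrite addr0.
- by rewrite add0r.
Qed.

Lemma exp_annihilation2 :
  annihilating (distr_exp (@annihilation2 K M)) (two_sided 1).
Proof. exact/two_sided_exp/annihilation2E. Qed.

Lemma exp_opp_annihilation2 :
  annihilating (distr_exp (distr_opp (@annihilation2 K M))) (two_sided (-1)).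
Proof.
apply: two_sided_exp => n v; rewrite /distr_opp annihilation2E -scaleNr.
by congr (_ *: _); case: ifP; rewrite ?oppr0 // mulNr.
Qed.

Lemma exp_annihilation :
  annihilating (distr_exp (@annihilation K M)) (fun i => if 0 < i then 1 else 0).
Proof.
pose c n : K := if 0 < n then n%:~R^-1 else 0.
have -> : @annihilation K M = (fun n v => c n *: heis M `|n|%N v).
  apply/funext => n; apply/funext => v; rewrite /annihilation /c.
  by case: ifP => [n0|_]; rewrite ?scale0r // gez0_abs //; lia.
have -> : (fun i => if 0 < i then 1 else 0 : K) = (fun i => c i * `|i|%N%:R).
  apply/funext => i; rewrite /c; case: ifP => i0; last by rewrite mul0r.
  have -> : i%:~R = `|i|%N%:R :> K by rewrite -{1}[i]gez0_abs //; lia.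
  by rewrite mulVf // (pcharf0P K).1 //; lia.
by apply: annihilation_exp.
Qed.

Lemma exp_creation : creating (distr_exp (@creation K M)) 1.
Proof.
have -> : @creation K M =
    (fun n v => (if 0 < n then 1 / n%:~R else 0) *: heis M (- n) v).
  apply/funext => n; apply/funext => v; rewrite /creation div1r.
  by case: ifP; rewrite ?scale0r.
exact: creation_exp.
Qed.

Lemma exp_opp_creation : creating (distr_exp (distr_opp (@creation K M))) (-1).
Proof.
have -> : distr_opp (@creation K M) =
    (fun n v => (if 0 < n then -1 / n%:~R else 0) *: heis M (- n) v).
  apply/funext => n; apply/funext => v; rewrite /distr_opp /creation mulN1r.
  by case: ifP; rewrite ?scale0r ?oppr0 ?scaleNr.
exact: creation_exp.
Qed.

Lemma two_sided_sym (T : distr M) (eta : K) n v :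
  annihilating T (two_sided eta) -> T (- n) v = T n v.
Proof.
move=> HT; move: v n; apply: creation_ind => [n|c u v IHu IHv n|k v k0 IH n].
- by rewrite !(ann_vac HT) oppr_eq0.
- by rewrite !(ann_lin HT) IHu IHv.
- rewrite !(two_sided_comm _ _ HT) // IH; congr (_ + _ *: _).
  rewrite (_ : - n - k%:Z = - (n + k%:Z)); last by ring.
  by rewrite (_ : - n + k%:Z = - (n - k%:Z)) ?IH 1?addrC //; ring.
Qed.

(** Commutators with the a_{-k} and the action on the vacuum suffice, so [T] may be any family with
    these properties, in particular one built from a fixed operator. *)
Lemma two_sided_commute (F : distr M) (eta : K) (T : int -> M -> M) (eta' : K)
    (t : int -> K) :
  annihilating F (two_sided eta) ->
  (forall p (c : K) u v, T p (c *: u + v) = c *: T p u + T p v) ->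
  (forall p k v, (0 < k)%N -> T p (heis M (- k%:Z) v) =
     heis M (- k%:Z) (T p v) + eta' *: (T (p - k%:Z) v + T (p + k%:Z) v)) ->
  (forall p, T p (vac M) = t p *: vac M) ->
  forall n p v, T p (F n v) = F n (T p v).
Proof.
move=> HF Tlin Tcomm Tvac n p v.
have T0 q : T q 0 = 0 := lin_0 (Tlin q).
have TD q : {morph T q : x y / x + y} := lin_D (Tlin q).
have TZ q (c : K) w : T q (c *: w) = c *: T q w := lin_Z (Tlin q) c w.
have FZ q (c : K) w : F q (c *: w) = c *: F q w := lin_Z (ann_lin HF q) c w.
have FD q := ann_add q HF.
move: v n p; apply: creation_ind => [n p|c u v IHu IHv n p|k v k0 IH n p].
- rewrite Tvac FZ (ann_vac HF); case: ifP => _; first exact: Tvac.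
  by rewrite T0 scaler0.
- by rewrite (ann_lin HF) !Tlin (ann_lin HF) IHu IHv.
- rewrite (two_sided_comm _ _ HF) // Tcomm // TD TZ TD Tcomm //.
  rewrite FD FZ FD (two_sided_comm _ _ HF) // !IH.
  by rewrite -!addrA; congr (_ + _); rewrite addrC.
Qed.

Section Vertex.
Variables (E F : distr M) (eps eta : K).
Hypotheses (HE : creating E eps) (HF : annihilating F (two_sided eta)).
Let V := distr_mul E F.

Lemma vertex_finsupp n v : finsupp_int (fun i => E i (F (n - i) v)).
Proof.
have [d dv] := ex_deg_lt v.
apply: (@finsupp_int_between _ _ 0 (n + d%:Z)) => i ni.
  by rewrite (cre_neg HE).
by rewrite (ann_fin HF dv) ?(cre_zero _ HE) //; lia.
Qed.

Lemma vertex_lin n (c : K) u v : V n (c *: u + v) = c *: V n u + V n v.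
Proof.
rewrite /V /distr_mul -!/(zsum _).
under eq_zsum => i do rewrite (ann_lin HF) (cre_lin HE).
rewrite zsumD; [|by apply: finsupp_int_sub (vertex_finsupp n u) => i ->;
  rewrite scaler0|exact: vertex_finsupp].
rewrite (@zsum_morph _ _ (fun w : M => c *: w)) ?scaler0 //.
  exact: scalerDr.
exact: vertex_finsupp.
Qed.

Lemma vertex_comm n k v : (0 < k)%N -> V n (heis M (- k%:Z) v) =
  heis M (- k%:Z) (V n v) + eta *: (V (n - k%:Z) v + V (n + k%:Z) v).
Proof.
move=> k0; rewrite /V /distr_mul -!/(zsum _).
have fin := vertex_finsupp.
have ED i := cre_add i HE.
rewrite (zsum_morph (linear0 _) (linearD (heis M (- k%:Z))) (fin n v)).
rewrite -zsumD // (@zsum_morph _ _ (fun w : M => eta *: w)) ?scaler0 //;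
  first 1 last.
- exact: scalerDr.
- exact: finsupp_intD.
rewrite -zsumD; first 1 last.
- by apply: finsupp_int_sub (fin n v) => i ->; rewrite linear0.
- have fin2 := finsupp_intD (fin (n - k%:Z) v) (fin (n + k%:Z) v).
  by apply: finsupp_int_sub fin2 => i ->; rewrite scaler0.
apply: eq_zsum => i; rewrite (two_sided_comm _ _ HF) // ED (cre_comm HE) //.
congr (_ + _); rewrite (cre_scale _ _ _ HE) ED.
by rewrite (addrAC n) (addrAC n k%:Z).
Qed.

Lemma vertex_vac n : V n (vac M) = E n (vac M).
Proof.
rewrite /V /distr_mul -/(zsum _) (@zsum1 _ _ n) => [|i ni].
  by rewrite (ann_vac HF) subrr.
by rewrite (ann_vac HF) ifN ?(cre_zero _ HE) //; lia.
Qed.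

Lemma vertex_low d n v : deg_lt d v -> n <= - d%:Z -> V n v = 0.
Proof.
move=> dv nd; apply: zsum0 => i; case: (ltP i 0) => i0.
  by rewrite (cre_neg HE).
by rewrite (ann_fin HF dv) ?(cre_zero _ HE) //; lia.
Qed.

(** By Newton's identity n E_n v is a sum of vectors a_{-i} w, all killed by the dual vacuum. *)
Lemma dvac_cre n v : n != 0 -> dvac M (E n v) = 0.
Proof.
move=> n0; case: (ltP n 0) => [ltn0|gtn0].
  by rewrite (cre_neg HE) // linear0.
apply: (mulfI (intr_neq0 charK n0)); rewrite mulr0.
have <- : dvac M (n%:~R *: E n v) = n%:~R * dvac M (E n v) by exact: linearZ.
rewrite (cre_newton HE).
have [dM0 dMD] := (linear0 (dvac M), linearD (dvac M)).
have -> (c : K) w : dvac M (c *: w) = c * dvac M w by exact: linearZ.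
rewrite (zsum_morph dM0 dMD); last first.
  by apply: (@newton_sum_finsupp _ _ (E^~ v)) => k k0; rewrite (cre_neg HE).
by rewrite zsum0 ?mulr0 // => i; case: ifP => // i0; rewrite ?dvac_heis ?dM0.
Qed.

Lemma dvac_vertex n v : dvac M (V n v) = dvac M (F n v).
Proof.
rewrite /V /distr_mul -/(zsum _).
rewrite (zsum_morph (linear0 (dvac M)) (linearD (dvac M)) (vertex_finsupp _ _)).
by rewrite (@zsum1 _ _ 0) => [|i i0]; rewrite ?subr0 ?(cre_0 HE) ?dvac_cre.
Qed.

(** In generating form, (1 - z w) (1 - z / w) V(w) E2(z)|0> = E(w) E2(z)|0>: the factor moves F(w)
    past E2(z) onto the vacuum, which it fixes. *)
Lemma vertex_cre_vac E2 (eps2 : K) n p :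
  creating E2 eps2 -> eps2 * eta = 1 ->
  V p (E2 n (vac M)) - V (p - 1) (E2 (n - 1) (vac M))
    - V (p + 1) (E2 (n - 1) (vac M)) + V p (E2 (n - 2) (vac M)) =
  E p (E2 n (vac M)).
Proof.
move=> HE2 epseta; rewrite /V /distr_mul -!/(zsum _).
rewrite zsum_combine4; try exact: vertex_finsupp.
have exch := cre_ann_exchange charK HE2 epseta (ann_lin HF)
  (fun q k v => @two_sided_comm F eta q k v HF).
transitivity (zsum (fun i => E i (E2 n (F (p - i) (vac M))))).
  apply: eq_zsum => i; rewrite exch !(cre_add _ HE) !(cre_opp _ _ HE).
  by rewrite (addrAC p) (addrAC p 1).
rewrite (@zsum1 _ _ p) => [|i ip]; first by rewrite subrr (ann_vac HF).
by rewrite (ann_vac HF) ifN ?(cre_zero _ HE2) ?(cre_zero _ HE) //; lia.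
Qed.

(** In generating form, V(z) T(w) = (1 - z w) (1 - z / w) T(w) V(z): only the creating half of V
    contributes, since [F] commutes with [T]. *)
Lemma vertex_exchange (T : int -> M -> M) (eta' : K) (t : int -> K) n p v :
  eps * eta' = 1 ->
  (forall p (c : K) u v, T p (c *: u + v) = c *: T p u + T p v) ->
  (forall p k v, (0 < k)%N -> T p (heis M (- k%:Z) v) =
     heis M (- k%:Z) (T p v) + eta' *: (T (p - k%:Z) v + T (p + k%:Z) v)) ->
  (forall p, T p (vac M) = t p *: vac M) ->
  V n (T p v) = T p (V n v) - T (p - 1) (V (n - 1) v)
    - T (p + 1) (V (n - 1) v) + T p (V (n - 2) v).
Proof.
move=> epseta Tlin Tcomm Tvac.
have exch := cre_ann_exchange charK HE epseta Tlin Tcomm.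
have comm := two_sided_commute HF Tlin Tcomm Tvac.
have T0 q : T q 0 = 0 := lin_0 (Tlin q).
have TD q : {morph T q : x y / x + y} := lin_D (Tlin q).
have fin (m : int) q : finsupp_int (fun i => T q (E i (F (m - i) v))).
  by apply: finsupp_int_sub (vertex_finsupp m v) => i ->.
have fin_shift (m : int) q :
    finsupp_int (fun i => T q (E (i - m) (F (n - i) v))).
  have := finsupp_int_shift m (fin (n - m) q); congr finsupp_int.
  by apply/funext => i; congr (T _ (E _ (F _ _))); ring.
have shift (m : int) q :
    T q (V (n - m) v) = zsum (fun i => T q (E (i - m) (F (n - i) v))).
  rewrite /V /distr_mul -/(zsum _) (zsum_morph (T0 q) (TD q)) //; last first.
    exact: vertex_finsupp.
  rewrite -(zsum_shift _ m); apply: eq_zsum => i.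
  by congr (T _ (E _ (F _ _))); ring.
have -> : T p (V n v) = zsum (fun i => T p (E i (F (n - i) v))).
  by rewrite -[n in V n]subr0 shift; apply: eq_zsum => i; rewrite subr0.
rewrite !shift zsum_combine4 //.
by apply: eq_zsum => i; rewrite -exch comm.
Qed.

End Vertex.
End VertexOperators.

(** * Fermion relations *)

Section FermionRelations.
Implicit Types (n p i s : int).

Lemma int_const (T : Type) (f : int -> T) : (forall n, f n = f (n - 1)) ->
  forall n, f n = f (- 1 : int).
Proof.
move=> fS; suff fD (m : nat) n : f n = f (n - m%:Z).
  move=> n; case: (ltP n (- 1 : int)) => n1.
    by rewrite (fD (absz (- 1 - n)%R) (- 1 : int)); congr f; lia.
  by rewrite (fD (absz (n + 1)%R) n); congr f; lia.
elim: m n => [|m IH] n; first by rewrite subr0.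
by rewrite fS IH; congr f; lia.
Qed.

(* The relations say [(1 - z w) (1 - z / w) A = X = (1 - z w) (1 - w / z) B]
   for the generating functions in z (first index) and w, with expansions in
   opposite directions; so [(1 - z w) (A + (w / z) B)] is the diagonal of [X]
   times the formal delta function of [w / z]. *)
Lemma delta_relation (V : zmodType) (v0 : V) (A B X : int -> int -> V) :
  (forall n p, n < 0 -> A n p = 0) -> (forall n p, p < 0 -> B n p = 0) ->
  (forall n p, n < 0 -> X n p = 0) ->
  (forall n p, A n p - A (n - 1) (p - 1) - A (n - 1) (p + 1) + A (n - 2) p =
    X n p) ->
  (forall n p, B n p - B (n - 1) (p - 1) - B (n + 1) (p - 1) + B n (p - 2) =
    X n p) ->
  (forall s, zsum (fun i => X i (s - i)) = if s == 0 then v0 else 0) ->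
  let C n p := A n p + B (n + 1) (p - 1) in
  forall n p, C n p + C (n - 1) p - C n (p - 1) - C (n - 1) (p - 1) =
    if n + p == 0 then v0 else 0.
Proof.
move=> A0 B0 X0 AX BX Xdiag C.
(* [B'] is (1 - z w) B, so that (1 - w / z) B' = X. *)
pose B' n p := B n p - B (n - 1) (p - 1).
have B'X n p : B' n p - B' (n + 1) (p - 1) = X n p.
  rewrite -BX /B'.
  rewrite (_ : n + 1 - 1 = n); last by ring.
  by rewrite (_ : p - 1 - 1 = p - 2); [zmod|ring].
(* Along the line n + p = s the differences of [B'] are the values of [X], and [B'] vanishes once p
   < 0; hence [B' 0 s] is the whole sum of [X] over the line. *)
have B'0 s : B' 0 s = if s == 0 then v0 else 0.
  pose G i := B' (i - 1) (s - i + 1).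
  have -> : B' 0 s = G 1 by congr B'; ring.
  rewrite -(@zsum_telescope _ G (s + 1)) => [|i si]; last first.
    by rewrite /G /B' !B0 ?subr0 //; lia.
  rewrite -Xdiag -[RHS](zsum_shift _ 1); apply: eq_zsum => i; case: ifP => i0.
    rewrite -B'X /G; congr (B' _ _ - B' _ _); lia.
  by rewrite X0 //; lia.
(* [D] is (1 - z w) C. The two expressions of [X] give (1 - z / w) D = 0, so [D] is constant along
   each line n + p = s. *)
pose D n p := C n p - C (n - 1) (p - 1).
have DS n p : D n p = D (n - 1) (p + 1).
  apply/eqP; rewrite -subr_eq0 /D /C.
  rewrite (_ : p + 1 - 1 = p); last by ring.
  rewrite (_ : n - 1 - 1 = n - 2); last by ring.
  rewrite (_ : p - 1 - 1 = p - 2); last by ring.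
  rewrite (_ : n - 2 + 1 = n - 1); last by ring.
  rewrite (_ : n - 1 + 1 = n); last by ring.
  have := AX n p; rewrite -(B'X n p) /B'.
  rewrite (_ : n + 1 - 1 = n); last by ring.
  rewrite (_ : p - 1 - 1 = p - 2); last by ring.
  move=> AB; apply/eqP; transitivity (
    (A n p - A (n - 1) (p - 1) - A (n - 1) (p + 1) + A (n - 2) p) -
    (B n p - B (n - 1) (p - 1) - (B (n + 1) (p - 1) - B n (p - 2)))); first zmod.
  by rewrite AB subrr.
(* The constant is read off at first index -1, where [A] contributes nothing and [D] reduces to
   [B' 0 (n + p)]. *)
have DE n p : D n p = if n + p == 0 then v0 else 0.
  have := @int_const _ (fun i => D i (n + p - i)) _ n.
  rewrite (_ : n + p - n = p) => [->|]; last by ring.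
    rewrite /D /C !A0 // !add0r -B'0 /B'.
    by congr (B _ _ - B _ _); ring.
  by move=> i; rewrite DS; congr D; ring.
move=> n p; set Theta := LHS.
(* The left side is (1 + z) (1 - w) C. On the delta function of w / z the factor (1 + z) (1 - w)
   acts as 1 - z w, so (1 - z w) G = 0 and [G] is invariant under diagonal shifts. *)
pose G n p := C n p + C (n - 1) p - C n (p - 1) - C (n - 1) (p - 1) -
  if n + p == 0 then v0 else 0.
suff : G n p = 0 by move/eqP; rewrite subr_eq0 => /eqP.
have GS n' p' : G n' p' = G (n' - 1) (p' - 1).
  apply/eqP; rewrite -subr_eq0; apply/eqP.
  transitivity ((D n' p' - (if n' + p' == 0 then v0 else 0)) +
    (D (n' - 1) p' - (if n' - 1 + p' == 0 then v0 else 0)) -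
    (D n' (p' - 1) - (if n' + (p' - 1) == 0 then v0 else 0)) -
    (D (n' - 1) (p' - 1) - (if n' - 1 + (p' - 1) == 0 then v0 else 0))).
    rewrite /G /D (_ : n' - 1 + p' = n' + (p' - 1)); last by ring.
    zmod.
  by rewrite !DE; zmod.
have GD (m : nat) : G n p = G (n - m%:Z) (p - m%:Z).
  elim: m => [|m ->]; first by rewrite !subr0.
  by rewrite GS; congr G; lia.
(* A shift that makes both indices negative, where [A], [B] and the delta term all vanish. *)
rewrite (GD (`|n| + `|p|).+1) /G /C ifN; last by lia.
by rewrite !A0 ?B0; [zmod | lia ..].
Qed.

Context {K : fieldType} (charK : [pchar K] =i pred0) (M : fockSpace K).
Implicit Types (u v w : M) (k d m : nat).

Local Notation E1 := (distr_exp (@creation K M)).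
Local Notation E2 := (distr_exp (distr_opp (@creation K M))).
Local Notation F1 := (distr_exp (distr_opp (@annihilation2 K M))).
Local Notation F2 := (distr_exp (@annihilation2 K M)).
Local Notation V1 := (distr_mul E1 F1).
Local Notation V2 := (distr_mul E2 F2).
Let HE1 : creating E1 1 := exp_creation charK M.
Let HE2 : creating E2 (-1) := exp_opp_creation charK M.
Let HF1 : annihilating F1 (two_sided (-1)) := exp_opp_annihilation2 charK M.
Let HF2 : annihilating F2 (two_sided 1) := exp_annihilation2 charK M.
Local Notation Ud := (@U_distr K M).
Local Notation Us := (@Ustar_distr K M).

Let UdE n v : Ud n v = V1 n v + V1 (n - 1) v.
Proof. by rewrite /U_distr /distr_mul_lin scale1r. Qed.

Let UsE n v : Us n v = V2 n v - V2 (n - 1) v.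
Proof. by rewrite /Ustar_distr /distr_mul_lin scaleN1r. Qed.

Lemma U_distr_lin n (c : K) u v : Ud n (c *: u + v) = c *: Ud n u + Ud n v.
Proof. by rewrite !UdE !(vertex_lin HE1 HF1) scalerDr; zmod. Qed.

Lemma Ustar_distr_lin n (c : K) u v : Us n (c *: u + v) = c *: Us n u + Us n v.
Proof. by rewrite !UsE !(vertex_lin HE2 HF2) scalerBr; zmod. Qed.

Lemma U_distr_comm n k v : (0 < k)%N -> Ud n (heis M (- k%:Z) v) =
  heis M (- k%:Z) (Ud n v) - (Ud (n - k%:Z) v + Ud (n + k%:Z) v).
Proof.
move=> k0; rewrite !UdE !(vertex_comm HE1 HF1) // !scaleN1r heisD.
rewrite (_ : n - k%:Z - 1 = n - 1 - k%:Z); last by ring.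
by rewrite (_ : n + k%:Z - 1 = n - 1 + k%:Z); [zmod|ring].
Qed.

Lemma Ustar_distr_comm n k v : (0 < k)%N -> Us n (heis M (- k%:Z) v) =
  heis M (- k%:Z) (Us n v) + (Us (n - k%:Z) v + Us (n + k%:Z) v).
Proof.
move=> k0; rewrite !UsE !(vertex_comm HE2 HF2) // !scale1r heisB.
rewrite (_ : n - k%:Z - 1 = n - 1 - k%:Z); last by ring.
by rewrite (_ : n + k%:Z - 1 = n - 1 + k%:Z); [zmod|ring].
Qed.

Lemma U_distr_low v : exists B : nat, forall n, n < - B%:Z -> Ud n v = 0.
Proof.
have [d dv] := ex_deg_lt v; exists d => n nd.
by rewrite UdE !(vertex_low HE1 HF1 dv) ?addr0 //; lia.
Qed.

(** Under the dual vacuum only (1 - z) F(z) is left of U^*(z), with F(z) = F(1 / z); the prefactor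
    turns this symmetry into an antisymmetry about a half-integer. *)
Lemma dvac_Ustar_distr n v : dvac M (Us (- n) v) = - dvac M (Us (n + 1) v).
Proof.
rewrite !UsE !linearB /= !(dvac_vertex charK HE2 HF2).
rewrite (two_sided_sym n v HF2) -(two_sided_sym (- n - 1) v HF2).
by rewrite (_ : - (- n - 1) = n + 1) ?addrK ?opprB //; ring.
Qed.

Lemma Ustar_distr_vac n : n <= 0 ->
  Us n (vac M) = if n == 0 then vac M else 0.
Proof.
move=> n0; rewrite UsE !(vertex_vac HE2 HF2).
rewrite [E2 (n - 1) _](cre_neg HE2) ?subr0; last by lia.
by case: eqP => [->|?]; rewrite ?(cre_0 HE2) // (cre_neg HE2) //; lia.
Qed.

Lemma anticommutator_ind (T S : int -> M -> M) :
  (forall n, linear (T n)) -> (forall n, linear (S n)) ->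
  (forall n k v, (0 < k)%N -> T n (heis M (- k%:Z) v) =
     heis M (- k%:Z) (T n v) - (T (n - k%:Z) v + T (n + k%:Z) v)) ->
  (forall n k v, (0 < k)%N -> S n (heis M (- k%:Z) v) =
     heis M (- k%:Z) (S n v) + (S (n - k%:Z) v + S (n + k%:Z) v)) ->
  (forall n p, S p (T n (vac M)) + T (n + 1) (S (p - 1) (vac M)) =
     if n + p == 0 then vac M else 0) ->
  forall v n p, S p (T n v) + T (n + 1) (S (p - 1) v) =
    if n + p == 0 then v else 0.
Proof.
move=> Tlin Slin Tcomm Scomm STvac.
apply: creation_ind => // [c u v IHu IHv n p|k v k0 IH n p].
  rewrite !(Tlin, Slin) addrACA -scalerDr IHu IHv.
  by case: ifP => _; rewrite ?scaler0 ?addr0.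
rewrite Tcomm // Scomm // !(lin_D (Slin _)) !(lin_D (Tlin _)).
rewrite !(lin_N (Slin _)) !(lin_D (Slin _)) Scomm // Tcomm //.
transitivity (heis M (- k%:Z) (S p (T n v) + T (n + 1) (S (p - 1) v))
  - (S p (T (n - k%:Z) v) + T (n - k%:Z + 1) (S (p - 1) v))
  - (S p (T (n + k%:Z) v) + T (n + k%:Z + 1) (S (p - 1) v))
  + (S (p - k%:Z) (T n v) + T (n + 1) (S (p - k%:Z - 1) v))
  + (S (p + k%:Z) (T n v) + T (n + 1) (S (p + k%:Z - 1) v))).
  rewrite heisD (_ : n - k%:Z + 1 = n + 1 - k%:Z); last by ring.
  rewrite (_ : n + k%:Z + 1 = n + 1 + k%:Z); last by ring.
  rewrite (_ : p - k%:Z - 1 = p - 1 - k%:Z); last by ring.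
  by rewrite (_ : p + k%:Z - 1 = p - 1 + k%:Z); [zmod|ring].
(* The right side depends on n + p only, so lowering [n] by k cancels against lowering [p] by k, and
   likewise for raising. *)
rewrite !IH (_ : n + (p - k%:Z) = n - k%:Z + p); last by ring.
rewrite (_ : n + (p + k%:Z) = n + k%:Z + p); last by ring.
by case: (n + p == 0); rewrite ?linear0; zmod.
Qed.

Lemma Ustar_U_relation n p v :
  Us p (Ud n v) + Ud (n + 1) (Us (p - 1) v) = if n + p == 0 then v else 0.
Proof.
move: v n p; apply: anticommutator_ind => //.
- exact: U_distr_lin.
- exact: Ustar_distr_lin.
- exact: U_distr_comm.
- exact: Ustar_distr_comm.
(* On the vacuum, U^*(w) U(z) and U(z) U^*(w) reduce to A = V2(w) E1(z)|0> and B = V1(z) E2(w)|0>,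
   up to the prefactors. Their common value X is E2(w) E1(z)|0>, whose sum along a line n + p = s is
   that of inverse series. *)
- move=> n p; pose A n p := V2 p (E1 n (vac M)).
  pose B n p := V1 n (E2 p (vac M)).
  rewrite -(@delta_relation _ (vac M) A B (fun n p => E2 p (E1 n (vac M)))).
  + rewrite UsE !UdE !UsE !(vertex_vac HE1 HF1) !(vertex_vac HE2 HF2).
    rewrite !(lin_D (vertex_lin HE1 HF1 _)) !(lin_D (vertex_lin HE2 HF2 _)).
    rewrite !(lin_N (vertex_lin HE1 HF1 _)) /A /B.
    rewrite (_ : n + 1 - 1 = n); last by ring.
    by rewrite (_ : n - 1 + 1 = n); [zmod|ring].
  + move=> {}n {}p n0; rewrite /A (cre_neg HE1) //.
    exact: lin_0 (vertex_lin HE2 HF2 _).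
  + move=> {}n {}p p0; rewrite /B (cre_neg HE2) //.
    exact: lin_0 (vertex_lin HE1 HF1 _).
  + by move=> {}n {}p n0; rewrite (cre_neg HE1) // (cre_zero _ HE2).
  + by move=> {}n {}p; rewrite /A (vertex_cre_vac charK HE2 HF2 _ _ HE1) ?mulr1.
  + move=> {}n {}p; rewrite /B (cre_commute charK _ _ _ HE2 HE1).
    by rewrite -(vertex_cre_vac charK HE1 HF1 _ _ HE2) ?mulrNN ?mulr1.
  + move=> s; rewrite -(cre_inverse charK s (vac M) HE1 HE2).
    by apply: eq_zsum => i; rewrite (cre_commute charK _ _ _ HE2 HE1).
Qed.

(** * Exchange of the half vertex operators with the modes of U *)

Lemma Gamma_plus_lin (y : K) : linear (@Gamma_plus K M y).
Proof.
move=> c u v; rewrite /Gamma_plus /distr_eval -!/(zsum _).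
have HG := exp_annihilation charK M.
have fin w : finsupp_int (fun n => y ^ n *: distr_exp (@annihilation K M) n w).
  have [d dw] := ex_deg_lt w; exists d => n dn.
  by rewrite (ann_fin HG dw) ?scaler0 //; lia.
rewrite (@zsum_morph _ _ (fun w : M => c *: w)) ?scaler0 //; last first.
  exact: scalerDr.
rewrite -zsumD //; last first.
  by apply: finsupp_int_sub (fin u) => n ->; rewrite scaler0.
apply: eq_zsum => n; rewrite (ann_lin HG) scalerDr !scalerA.
by rewrite [y ^ n * c]mulrC.
Qed.

Lemma Gamma_plus_comm (y : K) k v : y != 0 -> (0 < k)%N ->
  @Gamma_plus K M y (heis M (- k%:Z) v) =
  heis M (- k%:Z) (@Gamma_plus K M y v) + y ^ k *: @Gamma_plus K M y v.
Proof.
move=> y0 k0; rewrite /Gamma_plus /distr_eval -!/(zsum _).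
have := exp_annihilation charK M; set G := distr_exp _ => HG.
have fin w (m : int) : finsupp_int (fun n => y ^ n *: G (n - m) w).
  have [d dw] := ex_deg_lt w; exists (d + `|m|)%N => n dn.
  by rewrite (ann_fin HG dw) ?scaler0 //; lia.
have fin0 w : finsupp_int (fun n => y ^ n *: G n w).
  by apply: finsupp_int_sub (fin w 0) => n; rewrite subr0.
rewrite (zsum_morph (linear0 (heis M (- k%:Z))) (heisD (- k%:Z))) //.
rewrite (@zsum_morph _ _ (fun w : M => y ^ k *: w)) ?scaler0 //; last first.
  exact: scalerDr.
rewrite -[X in _ + X](zsum_shift _ k%:Z) -zsumD; first 1 last.
- by apply: finsupp_int_sub (fin0 v) => n ->; rewrite linear0.
- apply: finsupp_int_sub (fin v k) => n; rewrite scalerA -expfzDr //.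
  by rewrite addrCA subrr addr0.
apply: eq_zsum => n; rewrite (ann_comm HG) // ltz_nat k0 scale1r.
rewrite oppr_gt0 ltz_nat ltn0 scale0r addr0 scalerDr heisZ; congr (_ + _).
by rewrite scalerA -expfzDr // addrCA subrr addr0.
Qed.

Lemma Gamma_plus_vac (y : K) : @Gamma_plus K M y (vac M) = vac M.
Proof.
have HG := exp_annihilation charK M.
rewrite /Gamma_plus /distr_eval -/(zsum _) (@zsum1 _ _ 0) => [|n n0].
  by rewrite (ann_vac HG) expr0z scale1r.
by rewrite (ann_vac HG) (negbTE n0) scaler0.
Qed.

Local Notation Gamma_pair y := (@Gamma_plus K M y \o @Gamma_plus K M y^-1).

Lemma U_distr_Gamma_pair (y : K) n v : y != 0 ->
  Ud n (Gamma_pair y v) = Gamma_pair y (Ud n v)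
    - (y + y^-1) *: Gamma_pair y (Ud (n - 1) v) + Gamma_pair y (Ud (n - 2) v).
Proof.
(* The modes of the formal delta function of w / y times the fixed pair: a distribution in w to
   which [vertex_exchange] applies, and on which w acts as y. The factor thus becomes (1 - y z) (1 -
   z / y). *)
move=> y0; pose T p v := y ^ (- p) *: Gamma_pair y v.
have yV0 : y^-1 != 0 by rewrite invr_eq0.
have Glin : linear (Gamma_pair y).
  by move=> c u w; rewrite /= !Gamma_plus_lin.
have Tlin p : linear (T p).
  by move=> c u w; rewrite /T Glin scalerDr !scalerA mulrC.
have Tcomm p k w : (0 < k)%N -> T p (heis M (- k%:Z) w) =
    heis M (- k%:Z) (T p w) + 1 *: (T (p - k%:Z) w + T (p + k%:Z) w).
  move=> k0; rewrite /T /= !Gamma_plus_comm // (lin_D (Gamma_plus_lin y)).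
  rewrite (lin_Z (Gamma_plus_lin y)) Gamma_plus_comm // heisZ scale1r.
  rewrite !scalerDr !scalerA -addrA opprB opprD !expfzDr // exprz_inv.
  by rewrite [y ^ k * _]mulrC.
have Tvac p : T p (vac M) = y ^ (- p) *: vac M by rewrite /T /= !Gamma_plus_vac.
have V1T (m : int) : V1 m (Gamma_pair y v) = Gamma_pair y (V1 m v)
    - (y + y^-1) *: Gamma_pair y (V1 (m - 1) v) + Gamma_pair y (V1 (m - 2) v).
  have := vertex_exchange charK HE1 HF1 m 0 v (mulr1 1) Tlin Tcomm Tvac.
  rewrite /T oppr0 expr0z !scale1r sub0r opprK add0r expr1z exprN1 => ->.
  by rewrite scalerDl; zmod.
rewrite !UdE !V1T !(lin_D Glin) !scalerDr.
rewrite (_ : n - 1 - 1 = n - 2); last by ring.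
rewrite (_ : n - 1 - 2 = n - 2 - 1); last by ring.
zmod.
Qed.

End FermionRelations.

(** * Determinant of fermion modes *)

(* The abstract form of the computation: [S] and [T] play the roles of the modes
   of U^* and of Gamma U Gamma^{-1}, and [h] is their anticommutator.  Moving
   [S] through a product of [T]'s is a Laplace expansion along a column. *)
Section FermionDeterminant.
Context {K : fieldType} {V : lmodType K}.
Variables (S T : int -> V -> V) (h : int -> K) (v0 : V) (phi : {scalar V}).
Hypothesis Slin : forall p, linear (S p).
Hypothesis Tlin : forall m, linear (T m).
Hypothesis ST : forall p m v, S p (T m v) + T (m + 1) (S (p + 1) v) =
  h (m - p) *: v.
Hypothesis Sv0 : forall p : int, 0 <= p -> S p v0 = if p == 0 then v0 else 0.
Hypothesis phiS : forall p v, phi (S p v) = - phi (S (- p - 1) v).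
Hypothesis phiv0 : phi v0 = 1.

Definition mode_prod (ms : seq int) (v : V) : V := foldr T v ms.

Definition shift_seq (c : int) (ms : seq int) : seq int :=
  [seq m + c | m <- ms].

(** The indices left when [S] has passed the first [i] modes, raising each by one, and is contracted
    with the next one. *)
Definition drop_shift (ms : seq int) (i : nat) : seq int :=
  shift_seq 1 (take i ms) ++ drop i.+1 ms.

Lemma size_drop_shift ms i : (i < size ms)%N ->
  size (drop_shift ms i) = (size ms).-1.
Proof.
move=> ims; rewrite size_cat size_map size_drop size_takel ?(ltnW ims) //.
by case: (size ms) ims => // n; lia.
Qed.

Lemma nth_drop_shift ms i j : (i < size ms)%N -> (j < (size ms).-1)%N ->
  nth 0 (drop_shift ms i) j =
  if (j < i)%N then nth 0 ms j + 1 else nth 0 ms j.+1.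
Proof.
move=> ims jms; rewrite nth_cat size_map size_takel ?(ltnW ims) //.
case: ltnP => ij; first by rewrite (nth_map 0) ?nth_take ?size_takel // ltnW.
by rewrite nth_drop addSn subnKC.
Qed.

Lemma mode_prod_lin ms : linear (mode_prod ms).
Proof.
elim: ms => // m ms IH c u v.
by rewrite -[LHS]/(T m (mode_prod ms _)) IH Tlin.
Qed.

(** Each passage given by [ST] changes the sign and raises the index of [S] by one; this is the
    origin of the shift by [i] in the argument of [h]. *)
Lemma S_mode_prod p ms v : S p (mode_prod ms v) =
  \sum_(i < size ms) ((-1) ^+ i * h (nth 0 ms i - p - i%:Z)) *:
    mode_prod (drop_shift ms i) v +
  (-1) ^+ size ms *: mode_prod (shift_seq 1 ms) (S (p + (size ms)%:Z) v).
Proof.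
elim: ms p => [|m ms IH] p; first by rewrite big_ord0 add0r scale1r addr0.
have -> : S p (mode_prod (m :: ms) v) = h (m - p) *: mode_prod ms v -
    T (m + 1) (S (p + 1) (mode_prod ms v)) by rewrite -ST addrK.
rewrite IH (lin_D (Tlin _)) (lin_Z (Tlin _)) opprD addrA; congr (_ + _).
  rewrite big_ord_recl expr0 mul1r subr0 [drop_shift _ ord0]/drop_shift.
  rewrite take0 drop1; congr (_ + _).
  rewrite (big_morph _ (lin_D (Tlin _)) (lin_0 (Tlin _))) -sumrN.
  apply: eq_bigr => i _; rewrite lift0 (lin_Z (Tlin _)) -scaleNr exprS mulN1r.
  rewrite mulNr -[nth 0 (m :: ms) i.+1]/(nth 0 ms i).
  by congr (- (_ * h _) *: _); rewrite intS; ring.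
rewrite -scaleNr -[size (m :: ms)]/(size ms).+1 exprS mulN1r.
rewrite -[mode_prod (shift_seq 1 (m :: _)) _]/(T (m + 1) (mode_prod _ _)).
by congr (_ *: T _ (mode_prod _ (S _ _))); rewrite intS; ring.
Qed.

Lemma expand_vacuum (n : nat) (ms : seq int) : size ms = n ->
  phi (mode_prod ms v0) = \det (\matrix_(i < n, j < n)
    (h (nth 0 ms i - i%:Z + j%:Z) + h (nth 0 ms i - i%:Z - j%:Z - 1))).
Proof.
elim: n ms => [|n IH] ms sz.
  by rewrite (size0nil sz) /= phiv0 det_mx00.
(* The indices are lowered in advance, since a complete passage of [S] raises all of them by one and
   must end at [ms]. *)
pose ms' := shift_seq (-1) ms.
have sz' : size ms' = n.+1 by rewrite size_map.
have ms'E : shift_seq 1 ms' = ms.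
  by rewrite /ms' /shift_seq -map_comp map_id_in // => m _ /=; rewrite subrK.
have nth_ms' i : (i < n.+1)%N -> nth 0 ms' i = nth 0 ms i - 1.
  by move=> ni; rewrite (nth_map 0) ?sz.
have := phiS (- n.+1%:Z) (mode_prod ms' v0).
rewrite !S_mode_prod sz' ms'E.
rewrite (_ : - - n.+1%:Z - 1 = n%:Z); last by lia.
rewrite [- _ + _]addNr !Sv0 // eqxx.
rewrite (_ : (n%:Z + n.+1%:Z == 0) = false); last by lia.
rewrite (lin_0 (mode_prod_lin ms)) scaler0 addr0 linearD !linear_sum /=.
have phiZ c v : phi (c *: v) = c * phi v by exact: linearZ.
move=> /(canRL (addKr _)); rewrite -opprD phiZ => /(canRL (mulKf _)).
rewrite signr_eq0 => /(_ isT) ->.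
rewrite (expand_det_col _ ord_max) -big_split mulrN -mulNr mulr_sumr.
apply: eq_bigr => i _; rewrite /= !phiZ -mulrDl -mulrDr nth_ms' //.
rewrite IH ?size_drop_shift ?sz' // !mxE /cofactor /= invr_sign exprS mulN1r.
rewrite opprK exprD (_ : nth 0 ms i - 1 - - n.+1%:Z - i%:Z =
  nth 0 ms i - i%:Z + n%:Z); last by rewrite intS; ring.
rewrite (_ : nth 0 ms i - 1 - n%:Z - i%:Z = nth 0 ms i - i%:Z - n%:Z - 1);
  last by ring.
set Dl := \det _; set Dr := \det _; suff -> : Dl = Dr by ring.
(* In the minor without row [i], the rows above have -1 and +1 cancelling in their index; below, the
   -1 is absorbed by the row number having dropped by one. *)
congr (\det _); apply/matrixP => a b; rewrite !mxE.
rewrite nth_drop_shift ?sz' // (@nth_ms' a) ?(@nth_ms' a.+1);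
  [|exact: (ltn_ord a)|exact: (leqW (ltn_ord a))].
have -> : lift ord_max b = b :> nat by rewrite /= /bump leqNgt ltn_ord.
rewrite /= /bump [(i <= a)%N]leqNgt; case: ltnP => ai /=.
  by rewrite subrK add0n.
by rewrite add1n intS; congr (h _ + h _); ring.
Qed.

(** Indices start at 0 here. Each Laplace expansion raises every remaining difference m_i - i by one
    and lowers the column number by one. In the vacuum columns these effects cancel in the first
    summand and add up to twice [size ps] in the second. *)
Definition so_entry (ms : seq int) (ps : seq nat) (i j : nat) : K :=
  if (j < size ps)%N
  then h (nth 0 ms i - (nth 0%N ps j)%:Z - i%:Z + j%:Z)
  else h (nth 0 ms i - i%:Z + j%:Z) +
       h (nth 0 ms i - i%:Z - j%:Z + (size ps).*2%:Z - 1).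

Lemma expand_modes (ps : seq nat) (n : nat) (ms : seq int) :
  size ms = n -> (size ps <= n)%N ->
  phi (foldl (fun w p => S p%:Z w) (mode_prod ms v0) ps) =
  \det (\matrix_(i < n, j < n) so_entry ms ps i j).
Proof.
elim: ps n ms => [|p ps IH] n ms sz /=.
  move=> _; rewrite (expand_vacuum sz); congr (\det _).
  by apply/matrixP => i j; rewrite !mxE /so_entry /= addr0.
case: n sz => // n sz psn.
pose F v := phi (foldl (fun w q => S q%:Z w) v ps).
have Flin : linear (F : V -> K^o).
  rewrite /F; elim: (ps) => [|q qs IHq] c u v /=; first exact: linearP.
  by rewrite Slin IHq.
(* The index [p + n.+1] reached at the vacuum is positive, so the last term of the expansion
   vanishes. *)
rewrite -/(F _) S_mode_prod sz Sv0 // -PoszD addnS /=.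
rewrite (lin_0 (mode_prod_lin _)) scaler0 addr0.
rewrite (big_morph F (lin_D Flin) (lin_0 Flin)) (expand_det_col _ ord0).
apply: eq_bigr => i _; rewrite (lin_Z Flin) /F.
rewrite (IH n) ?size_drop_shift ?sz //.
rewrite -[LHS]/(_ * _ * _) !mxE /so_entry /= addr0 /cofactor addn0 mulrCA mulrA.
congr (_ * \det _).
apply/matrixP => a b; rewrite !mxE lift0 /= ltnS.
rewrite nth_drop_shift ?sz // /bump [(i <= a)%N]leqNgt.
case: ltnP => _; case: ltnP => ai /=; rewrite ?add0n ?add1n ?doubleS !intS.
- by congr h; ring.
- by congr h; ring.
- by congr (h _ + h _); ring.
- by congr (h _ + h _); ring.
Qed.

End FermionDeterminant.

(** * Conjugation by the half vertex operators *)

Section PolynomialShifts.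
Context {K : fieldType} {V : lmodType K}.
Implicit Types (P Q : {poly K}) (f : int -> V) (m : int).

(* The coefficient of z^m in [P(z) * sum_n f_n z^n]. *)
Definition poly_act P f m : V := \sum_(j < size P) P`_j *: f (m - j%:Z).

Lemma poly_actE (B : nat) P f m : (size P <= B)%N ->
  poly_act P f m = \sum_(j < B) P`_j *: f (m - j%:Z).
Proof.
move=> PB; rewrite /poly_act (big_ord_widen B (fun j => P`_j *: f (m - j%:Z))) //.
rewrite [RHS](bigID (fun j : 'I_B => (j < size P)%N)) /=.
rewrite [X in _ + X]big1 ?addr0 // => j; rewrite -leqNgt => Pj.
by rewrite nth_default ?scale0r.
Qed.

Lemma poly_actD P Q f m : poly_act (P + Q) f m = poly_act P f m + poly_act Q f m.
Proof.
pose B := (size P + size Q)%N.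
rewrite !(@poly_actE B) ?leq_addr ?leq_addl //; last first.
  by apply: leq_trans (size_polyD _ _) _; rewrite geq_max leq_addr leq_addl.
by rewrite -big_split; apply: eq_bigr => j _; rewrite coefD scalerDl.
Qed.

Lemma poly_actZ (c : K) P f m : poly_act (c *: P) f m = c *: poly_act P f m.
Proof.
rewrite (@poly_actE (size P)) ?size_scale_leq // scaler_sumr.
by apply: eq_bigr => j _; rewrite coefZ scalerA.
Qed.

Lemma poly_actMX P f m : poly_act (P * 'X) f m = poly_act P f (m - 1).
Proof.
rewrite (@poly_actE (size P).+1); last first.
  by apply: leq_trans (size_polyMleq _ _) _; rewrite size_polyX addn2.
rewrite big_ord_recl coefMX scale0r add0r; apply: eq_bigr => j _.
by rewrite coefMX lift0 /=; congr (_ *: f _); rewrite intS; ring.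
Qed.

Lemma poly_act_lin (g : V -> V) P f m : linear g ->
  g (poly_act P f m) = poly_act P (g \o f) m.
Proof.
move=> glin; rewrite (big_morph g (lin_D glin) (lin_0 glin)).
by apply: eq_bigr => j _; rewrite (lin_Z glin).
Qed.

Lemma poly_act_quadratic (x : K) P f m : x != 0 ->
  poly_act ((1 - x *: 'X) * (1 - x^-1 *: 'X) * P) f m =
  poly_act P f m - (x + x^-1) *: poly_act P f (m - 1) + poly_act P f (m - 2).
Proof.
move=> x0; have -> : (1 - x *: 'X) * (1 - x^-1 *: 'X) * P =
    P + (- (x + x^-1)) *: (P * 'X) + P * 'X * 'X.
  rewrite -!mul_polyC polyCN polyCD; set a := x%:P; set b := _^-1%:P.
  have ab : a * b = 1 by rewrite -polyCM divff.
  by transitivity (P + - (a + b) * (P * 'X) + a * b * (P * 'X * 'X));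
    [ring | rewrite ab mul1r].
rewrite !poly_actD poly_actZ !poly_actMX scaleNr.
by rewrite (_ : m - 1 - 1 = m - 2) //; ring.
Qed.

End PolynomialShifts.

Lemma zsum_sum (V : zmodType) (n : nat) (g : 'I_n -> int -> V) (B : nat) :
  (forall j i, (B < `|i|)%N -> g j i = 0) ->
  zsum (fun i => \sum_(j < n) g j i) = \sum_(j < n) zsum (g j).
Proof.
move=> gB; rewrite (@zsum_ord _ _ B) => [|i iB]; last first.
  by rewrite big1 // => j _; apply: gB.
rewrite exchange_big; apply: eq_bigr => j _.
by rewrite (@zsum_ord _ _ B) //; apply: gB.
Qed.

Section SkewCharacter.
Context {K : fieldType} (charK : [pchar K] =i pred0) (M : fockSpace K).
Context {N : nat} (x : 'I_N -> K) (x0 : forall i, x i != 0).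
Implicit Types (v w : M) (m n p : int).
Local Notation Ud := (@U_distr K M).
Local Notation Us := (@Ustar_distr K M).

Let q (i : 'I_N) : {poly K} := (1 - x i *: 'X) * (1 - (x i)^-1 *: 'X).
Let Q : {poly K} := \prod_(i < N) q i.

Lemma h_pm_neg n : n < 0 -> h_pm x n = 0.
Proof. by case: n. Qed.

Lemma h_pm_inverse n :
  \sum_(j < size Q) Q`_j * h_pm x (n - j%:Z) = (n == 0)%:R.
Proof.
have Q0 : Q`_0 = 1.
  rewrite -horner_coef0 horner_prod big1 // => i _.
  by rewrite /q !hornerE ?mulr0 ?subr0 ?mulr1.
case: (ltP n 0) => [n0|]; last case: n => // n _.
  by rewrite big1 => [|j _]; rewrite ?h_pm_neg ?mulr0 ?lt_eqF //; lia.
rewrite -(inv_coefP n Q0).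
pose B := (size Q + n.+1)%N.
(* Both sums are cut to the common range: [h_pm] vanishes for j > n, the coefficients of [Q] from
   [size Q] on. *)
transitivity (\sum_(j < B | (j < size Q)%N && (j < n.+1)%N)
    Q`_j * h_pm x (n%:Z - j%:Z)).
  rewrite (big_ord_widen B (fun j => Q`_j * h_pm x (n%:Z - j%:Z))) ?leq_addr //.
  rewrite (bigID (fun j : 'I_B => (j < n.+1)%N)) /= [X in _ + X]big1 ?addr0 //.
  by move=> j /andP[_ nj]; rewrite h_pm_neg ?mulr0 //; lia.
rewrite [RHS](big_ord_widen B (fun j => Q`_j * inv_coef Q (n - j))) ?leq_addl //.
rewrite [RHS](bigID (fun j : 'I_B => (j < size Q)%N)) /=.
rewrite [X in _ = _ + X]big1 ?addr0 => [|j /andP[_ jQ]]; last first.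
  by rewrite nth_default ?mul0r // leqNgt.
apply: eq_big => [j|j /andP[_ jn]]; first exact: andbC.
by rewrite subzn.
Qed.

(** In generating form, Q(z) Gamma U(z) = U(z) Gamma; each pair of variables contributes one
    quadratic factor of Q. *)
Lemma U_distr_Gamma_plus_pm m v :
  poly_act Q (fun n => Gamma_plus_pm x (Ud n v)) m = Ud m (Gamma_plus_pm x v).
Proof.
rewrite /Gamma_plus_pm /Q; elim: (index_enum _) m v => [|i r IH] m v.
  by rewrite !big_nil (@poly_actE _ _ 1) ?size_poly1 // big_ord1 coef1
    scale1r subr0.
rewrite !big_cons poly_act_quadratic //.
set G := \big[comp/id]_(j <- r) _; set P := \prod_(j <- r) _.
set G1 := Gamma_plus _ \o _.
have G1lin : linear G1 by move=> c u w; rewrite /G1 /= !Gamma_plus_lin.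
have actE n : poly_act P (fun n => (G1 \o G) (Ud n v)) n = G1 (Ud n (G v)).
  by rewrite -IH (poly_act_lin _ _ _ G1lin).
rewrite !actE; apply/esym; exact: (U_distr_Gamma_pair charK).
Qed.

Lemma Gamma_plus_pm_lin : linear (Gamma_plus_pm (M := M) x).
Proof.
rewrite /Gamma_plus_pm; elim: (index_enum _) => [|i r IH].
  by rewrite big_nil.
by rewrite big_cons => c u v /=; rewrite IH !Gamma_plus_lin.
Qed.

Lemma Gamma_plus_pm_vac : Gamma_plus_pm x (vac M) = vac M.
Proof.
rewrite /Gamma_plus_pm; elim: (index_enum _) => [|i r IH].
  by rewrite big_nil.
by rewrite big_cons /= IH !Gamma_plus_vac.
Qed.

(* The mode of [Gamma U(z) Gamma^{-1}] at z^m; see [dressed_mode_Gamma]. *)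
Definition dressed_mode m v : M := zsum (fun i => h_pm x i *: Ud (m - i) v).

Lemma dressed_mode_finsupp m v : finsupp_int (fun i => h_pm x i *: Ud (m - i) v).
Proof.
have [B vB] := U_distr_low charK v.
apply: (@finsupp_int_between _ _ 0 (m + B%:Z)) => i im.
  by rewrite h_pm_neg ?scale0r.
by rewrite vB ?scaler0 //; lia.
Qed.

Lemma dressed_mode_lin m : linear (dressed_mode m).
Proof.
move=> c u v; rewrite /dressed_mode; have fin := dressed_mode_finsupp.
rewrite (@zsum_morph _ _ (fun w : M => c *: w)) ?scaler0 //; last first.
  exact: scalerDr.
rewrite -zsumD //; last first.
  by apply: finsupp_int_sub (fin m u) => i ->; rewrite scaler0.
apply: eq_zsum => i; rewrite (U_distr_lin charK) scalerDr !scalerA.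
by rewrite [c * _]mulrC.
Qed.

(** Multiplies [U_distr_Gamma_plus_pm] by the series of the h_n, the inverse of Q; on a given vector
    the modes of U vanish in low degree, which makes the double sum finite. *)
Lemma dressed_mode_Gamma m v :
  Gamma_plus_pm x (Ud m v) = dressed_mode m (Gamma_plus_pm x v).
Proof.
pose f n := Gamma_plus_pm x (Ud n v).
have [B vB] := U_distr_low charK v.
have f0 n : n < - B%:Z -> f n = 0.
  by move=> nB; rewrite /f vB // (lin_0 Gamma_plus_pm_lin).
transitivity (zsum (fun i => h_pm x i *: poly_act Q f (m - i))); last first.
  by apply: eq_zsum => i; rewrite -U_distr_Gamma_plus_pm.
pose C := (`|m| + B + size Q)%N.
transitivity (zsum (fun i => \sum_(j < size Q)
    (Q`_j * h_pm x (i - j%:Z)) *: f (m - i))).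
  rewrite (@zsum1 _ _ 0) => [|i i0]; rewrite -scaler_suml h_pm_inverse.
    by rewrite eqxx scale1r subr0.
  by rewrite (negbTE i0) scale0r.
rewrite (@zsum_sum _ _ _ C) => [|j i iC]; last first.
  case: (ltP i j%:Z) => ij; first by rewrite h_pm_neg ?mulr0 ?scale0r //; lia.
  by rewrite f0 ?scaler0 //; lia.
transitivity (zsum (fun i => \sum_(j < size Q)
    h_pm x i *: (Q`_j *: f (m - i - j%:Z)))); last first.
  by apply: eq_zsum => i; rewrite scaler_sumr.
rewrite (@zsum_sum _ _ _ C) => [|j i iC]; last first.
  case: (ltP i 0) => i0; first by rewrite h_pm_neg ?scale0r.
  by rewrite f0 ?scaler0 //; lia.
apply: eq_bigr => j _; rewrite -[RHS](zsum_shift _ j%:Z); apply: eq_zsum => i.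
rewrite scalerA mulrC; congr (_ *: f _); ring.
Qed.

Lemma Ustar_dressed_relation p m v :
  Us (- p) (dressed_mode m v) + dressed_mode (m + 1) (Us (- (p + 1)) v) =
  h_pm x (m - p) *: v.
Proof.
have Slin := Ustar_distr_lin charK (M := M).
have fin := dressed_mode_finsupp.
rewrite /dressed_mode (zsum_morph (lin_0 (Slin _)) (lin_D (Slin _))) //.
rewrite -zsumD //; last first.
  by apply: finsupp_int_sub (fin m v) => i ->; rewrite (lin_0 (Slin _)).
transitivity (zsum (fun i =>
    h_pm x i *: (if m - i + - p == 0 then v else 0))).
  apply: eq_zsum => i; rewrite (lin_Z (Slin _)) -scalerDr; congr (_ *: _).
  rewrite -(Ustar_U_relation charK (m - i) (- p) v).
  rewrite (_ : m - i + 1 = m + 1 - i); last by ring.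
  by rewrite (_ : - p - 1 = - (p + 1)) //; ring.
rewrite (@zsum1 _ _ (m - p)) => [|i im]; first by rewrite ifT //; lia.
by rewrite ifN ?scaler0 //; lia.
Qed.

End SkewCharacter.

Theorem proposition3p1 (K : fieldType) (charK : [pchar K] =i pred0)
    (M : fockSpace K) (l N : nat) (hl : (1 <= l)%N) (hN : (1 <= N)%N)
    (mu : l.-tuple nat) (lam : (l + N).-tuple nat)
    (hmu : gpartition mu) (hlam : gpartition lam)
    (x : 'I_N -> K) (hx : forall i, x i != 0) :
  skew_so M lam mu x =
  \det (\matrix_(i < l + N, j < l + N)
    (* 1-based indices *)
    let: i' := i.+1%:Z in let: j' := j.+1%:Z in
    let: lam_i := (nth 0%N lam i)%:Z in let: mu_j := (nth 0%N mu j)%:Z in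
    if (j < l)%N then h_pm x (lam_i - mu_j - i' + j')
    else h_pm x (lam_i - i' + j') + h_pm x (lam_i - i' - j' + l.*2%:Z + 1)).
Proof.
pose S p := @Ustar_distr K M (- p).
pose T m := dressed_mode (M := M) x m.
have ketE (s : seq nat) : Gamma_plus_pm x (so_ket M s) =
    mode_prod T [seq p%:Z | p <- s] (vac M).
  elim: s => [|p s IH]; first exact: Gamma_plus_pm_vac.
  by rewrite /= /U opprK (dressed_mode_Gamma charK hx) IH.
have braE (s : seq nat) v :
    so_bra s v = dvac M (foldl (fun w p => S p%:Z w) v s) by [].
have Slin p : linear (S p) := Ustar_distr_lin charK (M := M) (- p).
have Tlin m : linear (T m) := dressed_mode_lin charK x m.
have ST p m v : S p (T m v) + T (m + 1) (S (p + 1) v) = h_pm x (m - p) *: v.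
  exact: Ustar_dressed_relation.
have Sv0 p : 0 <= p -> S p (vac M) = if p == 0 then vac M else 0.
  by move=> p0; rewrite /S Ustar_distr_vac ?oppr_eq0 ?oppr_le0.
have phiS p v : dvac M (S p v) = - dvac M (S (- p - 1) v).
  by rewrite /S dvac_Ustar_distr // (_ : - (- p - 1) = p + 1) //; ring.
rewrite /skew_so ketE braE.
rewrite (expand_modes Slin Tlin ST Sv0 phiS (dvac_vac M) (n := l + N));
  first last.
- by rewrite size_tuple leq_addr.
- by rewrite size_map size_tuple.
(* Passing to indices that start at 1 subtracts 2 from -i - j, which turns the -1 of [so_entry] into
   +1. *)
congr (\det _); apply/matrixP => i j; rewrite !mxE /so_entry size_tuple.
rewrite (nth_map 0%N) ?size_tuple //.
by case: (j < l)%N; [|congr (_ + _)]; congr h_pm; lia.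
Qed.
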